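(* For $0<\lambda\leq 1/128$, define $W_\lambda\colon[0,1]^2\to\mathbb{R}$ by \[ W_\lambda(x,y)=\frac12+\frac{\cos(\pi x)+\cos(\pi y)}8+\frac{\cos(\pi x)\cos(\pi y)}{16}+\sum_{n=2}^{\infty}\lambda^n\cos(n\pi x)\cos(n\pi y). \] Then, for every $0<\lambda\leq 1/128$, $W_\lambda$ is a nonconstant real-analytic finitely forcible kernel in $\mathcal{W}$. Moreover, the kernels $W_\lambda$ are pairwise non-weakly-isomorphic as $\lambda$ varies: if $\lambda,\lambda'\in(0,1/128]$ and $\lambda\neq\lambda'$, then $W_\lambda$ and $W_{\lambda'}$ are not weakly isomorphic.
   Context: A kernel is a bounded symmetric measurable function $[0,1]^2\to\mathbb{R}$; $\mathcal{W}$ denotes the space of all kernels. Kernels that agree almost everywhere are identified. A kernel is called real analytic if it extends to a real-analytic function on an open neighborhood of $[0,1]^2$. For a kernel $W$ and a finite simple graph $F$, the homomorphism density of $F$ in $W$ is \[ t(F,W)=\int_{[0,1]^{V(F)}}\prod_{ij\in E(F)}W(x_i,x_j)\prod_{i\in V(F)}\mathrm{d}x_i . \] Two kernels are weakly isomorphic if their homomorphism densities agree for every finite simple graph. A kernel $W\in\mathcal{W}$ is finitely forcible in $\mathcal{W}$ if there are finitely many finite simple graphs $F_1,\ldots,F_m$ such that every $U\in\mathcal{W}$ satisfying $t(F_i,U)=t(F_i,W)$ for $i=1,\ldots,m$ is weakly isomorphic to $W$. *)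

(* Defs.v *)
From HB Require Import structures.
From mathcomp Require Import all_boot all_order all_algebra.
From mathcomp Require Import all_classical all_reals all_analysis.
Import Order.TTheory GRing.Theory Num.Theory.
Import numFieldNormedType.Exports.

Set Implicit Arguments.
Unset Strict Implicit.
Unset Printing Implicit Defensive.

Local Open Scope classical_set_scope.
Local Open Scope ring_scope.

Section tuple_lebesgue_measure.
Variable R : realType.
Local Notation RT := (measurableTypeR R).

Definition cons_pair n (p : RT * n.-tuple RT) : n.+1.-tuple RT :=
  [tuple of p.1 :: p.2].

Lemma measurable_cons_pair n : measurable_fun [set: _] (@cons_pair n).
Proof. exact: measurable_cons. Qed.

Section step.
Variables (n : nat) (m : {sigma_finite_measure set (n.-tuple RT) -> \bar R}).

Definition lebesgue_cons : set (n.+1.-tuple RT) -> \bar R :=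
  pushforward (lebesgue_measure \x m)%E (@cons_pair n).

Let lebesgue_cons0 : lebesgue_cons set0 = 0%E.
Proof. by rewrite /lebesgue_cons /pushforward preimage_set0 measure0. Qed.

Let lebesgue_cons_ge0 A : (0 <= lebesgue_cons A)%E.
Proof. by rewrite /lebesgue_cons /pushforward; exact: measure_ge0. Qed.

Let lebesgue_cons_sigma_additive : semi_sigma_additive lebesgue_cons.
Proof.
move=> F mF tF mUF; rewrite /lebesgue_cons /pushforward preimage_bigcup.
apply: measure_semi_sigma_additive.
- by move=> n'; rewrite -[X in measurable X]setTI; exact: measurable_cons_pair.
- apply/trivIsetP => /= i j _ _ ij; rewrite -preimage_setI.
  by move/trivIsetP : tF => /(_ _ _ _ _ ij) ->//; rewrite preimage_set0.
- rewrite -preimage_bigcup -[X in measurable X]setTI.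
  exact: measurable_cons_pair.
Qed.

HB.instance Definition _ := isMeasure.Build _ _ _ lebesgue_cons
  lebesgue_cons0 lebesgue_cons_ge0 lebesgue_cons_sigma_additive.

Lemma lebesgue_cons_sigma_finite : sigma_finite [set: _] lebesgue_cons.
Proof.
have /sigma_finiteP[F1 [TF1 ndF1 F1oo]] := sigma_finiteT (@lebesgue_measure R).
have /sigma_finiteP[F2 [TF2 ndF2 F2oo]] := sigma_finiteT m.
pose g (x : n.+1.-tuple RT) : RT * n.-tuple RT :=
  (thead x, [tuple of behead x]).
have gK : cancel (@cons_pair n) g.
  by move=> [a t]; rewrite /g theadE; congr pair; apply: val_inj.
have mg : measurable_fun [set: _] g.
  by apply/measurable_fun_pairP; split;
    [exact: measurable_tnth|exact: measurable_behead].
exists (fun k => g @^-1` (F1 k `*` F2 k)).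
  apply/esym; rewrite -subTset => x _.
  have [i _ F1i] : (\bigcup_i F1 i) (g x).1 by rewrite -TF1.
  have [j _ F2j] : (\bigcup_i F2 i) (g x).2 by rewrite -TF2.
  exists (maxn i j) => //; split.
  - by move: F1i; exact/subsetPset/ndF1/leq_maxl.
  - by move: F2j; exact/subsetPset/ndF2/leq_maxr.
move=> k; have [mF1 F1k] := F1oo k; have [mF2 F2k] := F2oo k; split.
  by rewrite -[X in measurable X]setTI; apply: mg => //; exact: measurableX.
rewrite /lebesgue_cons /pushforward -comp_preimage.
rewrite (_ : g \o _ = id); last by apply/funext => x /=; rewrite gK.
by rewrite preimage_id product_measure1E// lte_mul_pinfty// ge0_fin_numE.
Qed.

HB.instance Definition _ := @Measure_isSigmaFinite.Build _ _ _ lebesgue_cons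
  lebesgue_cons_sigma_finite.

End step.

(* Lebesgue measure on R^n: the unit mass on the one-point space R^0, and
   R^(n+1) is identified with R x R^n. *)
Fixpoint tuple_lebesgue_measure n :
    {sigma_finite_measure set (n.-tuple RT) -> \bar R} :=
  if n is n'.+1 then lebesgue_cons (tuple_lebesgue_measure n')
  else \d_ [tuple].

Lemma measurable_box n (A : 'I_n -> set RT) :
  (forall i, measurable (A i)) ->
  measurable [set x : n.-tuple RT | forall i, A i (tnth x i)].
Proof.
move=> mA.
rewrite (_ : [set x | _] = \bigcap_(i in [set: 'I_n]) (@tnth n RT ^~ i @^-1` A i)).
  apply: fin_bigcap_measurable => // i _.
  by rewrite -[X in measurable X]setTI; exact: measurable_tnth.
by apply/seteqP; split => x /= Ax i => [_|]; exact: Ax.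
Qed.

Lemma tuple_lebesgue_measure_box n (A : 'I_n -> set RT) :
  (forall i, measurable (A i)) ->
  tuple_lebesgue_measure n [set x | forall i, A i (tnth x i)] =
  (\prod_(i < n) lebesgue_measure (A i))%E.
Proof.
elim: n A => [|n IH] A mA.
  rewrite big_ord0 /= diracE mem_set//; first by case.
rewrite big_ord_recl /= /lebesgue_cons /pushforward.
rewrite (_ : _ @^-1` _ =
    A ord0 `*` [set x | forall i, A (lift ord0 i) (tnth x i)]).
  rewrite product_measure1E; [by congr (_ * _)%E; apply: IH => i; exact: mA | exact: mA |].
  by apply: (@measurable_box n (fun i => A (lift ord0 i))) => i; exact: mA.
apply/seteqP; split => -[a t] /=.
  move=> Aat; split; first by have := Aat ord0; rewrite tnth0.
  by move=> i; have := Aat (lift ord0 i); rewrite tnthS.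
move=> [Aa At] i; case: (unliftP ord0 i) => [j|] ->.
  by rewrite tnthS.
by rewrite tnth0.
Qed.

End tuple_lebesgue_measure.

Section kernels.
Variable R : realType.
Local Notation RT := (measurableTypeR R).
Implicit Types U W : R -> R -> R.

Definition unit_square : set (RT * RT) := `[0, 1] `*` `[0, 1].

(* Kernels are total functions, but only their values on [0, 1]^2 matter.
   Measurability is with respect to Borel sets: every Lebesgue measurable kernel
   agrees almost everywhere with a Borel measurable one. *)
Definition is_kernel U : Prop :=
  [/\ measurable_fun unit_square (fun p => U p.1 p.2 : RT),
      exists M : R, {in `[0, 1] &, forall x y, `|U x y| <= M} &
      {in `[0, 1] &, forall x y, U x y = U y x}].

(* Almost everywhere, since kernels equal almost everywhere are identified. *)
Definition ae_constant U : Prop :=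
  exists c : R, \forall p \ae (lebesgue_measure \x lebesgue_measure)%E,
    unit_square p -> U p.1 p.2 = c.

(* Near p, g is the sum of a double power series in x - p.1 and y - p.2. The
   series is required to converge absolutely, so summing it along squares
   i, j < n loses no generality. *)
Definition real_analytic_at (g : R * R -> R) (p : R * R) : Prop :=
  exists (c : nat -> nat -> R) (r : R), 0 < r /\
    forall x y : R, `|x - p.1| < r -> `|y - p.2| < r ->
      cvgn (fun n => \sum_(i < n) \sum_(j < n)
              `|c i j * (x - p.1) ^+ i * (y - p.2) ^+ j|) /\
      (fun n => \sum_(i < n) \sum_(j < n)
              c i j * (x - p.1) ^+ i * (y - p.2) ^+ j) @ \oo --> g (x, y).

Definition real_analytic_kernel U : Prop :=
  exists (O : set (R * R)) (g : R * R -> R),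
    [/\ open O, unit_square `<=` O, forall p, O p -> real_analytic_at g p &
        forall p, unit_square p -> g p = U p.1 p.2].

End kernels.

(* Finite simple graphs, with vertex set {0, ..., gorder - 1}. *)
Record sgraph := SGraph {
  gorder : nat;
  gedge : rel 'I_gorder;
  gedge_sym : symmetric gedge;
  gedge_irr : irreflexive gedge }.

Section homomorphism_density.
Variable R : realType.
Local Notation RT := (measurableTypeR R).
Implicit Types (F : sgraph) (U W : R -> R -> R).

Definition unit_cube n : set (n.-tuple RT) :=
  [set x | forall i, tnth x i \in `[0%R : R, 1%R]].

(* Each edge is counted once, as the pair (i, j) with i < j. *)
Definition hom_density F U : R :=
  (\int[tuple_lebesgue_measure R (gorder F)]_(x in @unit_cube (gorder F))
    \prod_(ij : 'I_(gorder F) * 'I_(gorder F) |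
             (ij.1 < ij.2)%N && gedge ij.1 ij.2)
      U (tnth x ij.1) (tnth x ij.2))%R.

Definition weakly_isomorphic U W : Prop :=
  forall F, hom_density F U = hom_density F W.

Definition finitely_forcible W : Prop :=
  exists (m : nat) (F : 'I_m -> sgraph), forall U, is_kernel U ->
    (forall i, hom_density (F i) U = hom_density (F i) W) ->
    weakly_isomorphic U W.

Definition W_lambda (l : R) (x y : R) : R :=
  2^-1 + (cos (pi * x) + cos (pi * y)) / 8
  + cos (pi * x) * cos (pi * y) / 16
  + limn (fun N => \sum_(2 <= n < N)
      l ^+ n * cos (n%:R * pi * x) * cos (n%:R * pi * y)).

End homomorphism_density.

(* Main.v *)
Require Import Defs.
From mathcomp Require Import all_boot all_order all_algebra.
From mathcomp Require Import all_classical all_reals all_analysis.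
From mathcomp Require Import measurable_realfun ring lra zify.
Import Order.TTheory GRing.Theory Num.Theory.
Import numFieldNormedType.Exports.

(** In the coordinates u = cos (pi x), v = cos (pi y) the kernel W_lambda is

      1/2 + (u + v)/8 + u v/16 + E(u,v) - 1 - l u v,
      E(u,v) = sum_(n >= 0) l^n T_n(u) T_n(v),

    with T_n the Chebyshev polynomials.  Three features make it forcible.  The
    degree of x is 1/2 + u/8, so that u, hence every polynomial in u, is read off
    from pendant edges.  The T_n are eigenvectors of E, with the distinct
    eigenvalues 1, l/2, l^2/2, ..., because they are orthogonal for the law of u.
    Finally E is an average of two Poisson kernels, hence a quotient pnum / pden
    of polynomials (pden_ppart).

    Let U be a kernel, p = 8 deg U - 4, and subtract from U the terms that turned
    E into W_lambda, written with p for u and v; call the result F.  The forcing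
    conditions are F T_n(p) = eigval_n T_n(p) for n <= 4, and pden(p,p) F =
    pnum(p,p).  Each can be written as the vanishing of one linear combination of
    densities of simple graphs: the first as a mean square, which is a sum over
    paths of length two with pendant edges; the second as a C_4-density, which
    vanishes only if the kernel does (C4_weakly_zero).  A mean square of the second
    condition would need double edges, hence the C_4.

    These conditions determine U.  Applying pden F = pnum to T_n(p) gives a
    recurrence from which all T_n(p) are eigenvectors (eigenvector_step).
    Eigenvectors with distinct eigenvalues are orthogonal, and orthogonality to
    T_0 = 1 says that T_n(p) has mean 0 for n >= 1: p has the same moments as
    cos (pi x) (moment_pcoord).  In particular the moments of p are at most 1,
    which forces |p| <= 1 almost everywhere (mean_pclamp_sq0).  There pden is
    bounded below, so F = pnum / pden is a function of p (kernel_identified).  Thus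
    U and W_lambda are the same function of two coordinates with the same moments,
    and their densities agree (cube_mean_wfun_transfer).

    Almost everywhere equalities are never used pointwise: a function is shown to be
    negligible by showing that its product with every bounded measurable function
    has mean zero.  For kernels it is enough to test against products f(x) g(y),
    because in a simple graph the rest of the integrand factors in that way around
    any given edge (cube_mean_weakly_zero).

    The parameter is recovered from the density of an edge weighted by T_2(p) at both
    ends, which is l^2/4.  Analyticity is a Taylor expansion of every cosine: the
    n-th one costs a factor 2^n on a disc of radius ln 2 / pi, which l^n absorbs. *)

Set Implicit Arguments.
Unset Strict Implicit.
Unset Printing Implicit Defensive.

Local Open Scope classical_set_scope.
Local Open Scope ring_scope.

(** * Bounded measurable functions and Fubini *)

Section bounded_measurable.
Context {R : realType}.

Definition bmeas d (T : measurableType d) (f : T -> R) : Prop :=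
  measurable_fun [set: T] f /\ exists M : R, forall x, `|f x| <= M.

Section closure.
Context d (T : measurableType d).
Implicit Types f g : T -> R.

Lemma bmeas_cst c : bmeas (fun _ : T => c).
Proof. by split; [exact: measurable_cst|exists `|c|]. Qed.

Lemma bmeasD f g : bmeas f -> bmeas g -> bmeas (fun x => f x + g x).
Proof.
move=> [mf [M fM]] [mg [N gN]]; split; first exact: measurable_funD.
by exists (M + N) => x; rewrite (le_trans (ler_normD _ _))// lerD.
Qed.

Lemma bmeasN f : bmeas f -> bmeas (fun x => - f x).
Proof.
move=> [mf [M fM]]; split; first exact: measurable_funN.
by exists M => x; rewrite normrN.
Qed.

Lemma bmeasB f g : bmeas f -> bmeas g -> bmeas (fun x => f x - g x).
Proof. by move=> bf bg; apply: bmeasD => //; exact: bmeasN. Qed.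

Lemma bmeasM f g : bmeas f -> bmeas g -> bmeas (fun x => f x * g x).
Proof.
move=> [mf [M fM]] [mg [N gN]]; split; first exact: measurable_funM.
exists (M * N) => x; rewrite normrM ler_pM//.
Qed.

Lemma bmeasX f n : bmeas f -> bmeas (fun x => f x ^+ n).
Proof.
move=> bf; elim: n => [|n IH].
  by under eq_fun do rewrite expr0; exact: bmeas_cst.
by under eq_fun do rewrite exprS; exact: bmeasM.
Qed.

Lemma bmeas_sum I (s : seq I) (F : I -> T -> R) :
  (forall i, bmeas (F i)) -> bmeas (fun x => \sum_(i <- s) F i x).
Proof.
move=> bF; elim: s => [|i s IH].
  by under eq_fun do rewrite big_nil; exact: bmeas_cst.
by under eq_fun do rewrite big_cons; exact: bmeasD.
Qed.

Lemma bmeas_prod I (s : seq I) (F : I -> T -> R) :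
  (forall i, bmeas (F i)) -> bmeas (fun x => \prod_(i <- s) F i x).
Proof.
move=> bF; elim: s => [|i s IH].
  by under eq_fun do rewrite big_nil; exact: bmeas_cst.
by under eq_fun do rewrite big_cons; exact: bmeasM.
Qed.

Lemma bmeas_comp d' (T' : measurableType d') (f : T' -> R) (h : T -> T') :
  bmeas f -> measurable_fun [set: T] h -> bmeas (fun x => f (h x)).
Proof.
move=> [mf [M fM]] mh; split; first exact: measurableT_comp.
by exists M.
Qed.

Lemma bmeas_integrable (mu : {measure set T -> \bar R}) (D : set T) f :
  measurable D -> (mu D < +oo)%E -> bmeas f -> mu.-integrable D (EFin \o f).
Proof.
move=> mD Doo [mf [M fM]]; apply: measurable_bounded_integrable => //.
  exact: measurable_funTS.
exists M; split; first exact: num_real.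
by move=> x Mx y _; exact: le_trans (fM y) (ltW Mx).
Qed.

End closure.

Section fubini_bounded.
Context d1 d2 (T1 : measurableType d1) (T2 : measurableType d2).
Variable m2 : {sigma_finite_measure set T2 -> \bar R}.
Variable D2 : set T2.
Hypotheses (mD2 : measurable D2) (D2oo : (m2 D2 < +oo)%E).
Implicit Type f : T1 * T2 -> R.

Lemma bmeas_section1 f x : bmeas f -> bmeas (fun y => f (x, y)).
Proof. by move=> bf; apply: (bmeas_comp bf); exact: measurable_pair1. Qed.

Lemma bmeas_section2 f y : bmeas f -> bmeas (fun x => f (x, y)).
Proof. by move=> bf; apply: (bmeas_comp bf); exact: measurable_pair2. Qed.

(** Measurability in the parameter comes from Tonelli, hence for nonnegative
    integrands only: add a bound M of |f| and subtract its integral afterwards. *)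
Lemma bmeas_param f : bmeas f ->
  bmeas (fun x => \int[m2]_(y in D2) f (x, y)).
Proof.
move=> bf; have [mf [M fM]] := bf; split; last first.
  exists (M * fine (m2 D2)) => x.
  have bfx := bmeas_section1 x bf.
  apply: (le_trans (le_normr_Rintegral mD2 (bmeas_integrable mD2 D2oo bfx))).
  rewrite -Rintegral_cst//; apply: le_Rintegral => //.
    apply: bmeas_integrable => //; case: bfx => mg [N gN]; split.
      exact: measurableT_comp.
    by exists N => y; rewrite normr_id.
  by apply: bmeas_integrable => //; exact: bmeas_cst.
pose g (p : T1 * T2) := ((f p + M) * \1_([set: T1] `*` D2) p)%:E.
have mg : measurable_fun setT g.
  apply/measurable_EFinP; apply: measurable_funM.
    by apply: measurable_funD => //; exact: measurable_cst.
  by apply: measurable_indic; exact: measurableX.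
have g0 p : (0 <= g p)%E.
  rewrite lee_fin mulr_ge0//; have := fM p.
  by rewrite ler_norml => /andP[+ _]; rewrite -subr_ge0 opprK.
have mG := measurable_fun_fubini_tonelli_F (m2 := m2) g mg g0.
rewrite (_ : (fun x => _) =
    (fun x => fine (fubini_F m2 g x) - M * fine (m2 D2))).
  apply: measurable_funB; last exact: measurable_cst.
  exact: measurableT_comp.
apply/funext => x; rewrite /fubini_F.
have bfx := bmeas_section1 x bf.
have -> : fine (\int[m2]_y g (x, y))%E = \int[m2]_(y in D2) (f (x, y) + M).
  rewrite Rintegral_mkcond /Rintegral; congr fine; apply: eq_integral => y _.
  rewrite /g patchE indicE.
  case: ifPn => yD; [rewrite mem_set ?mulr1//|rewrite memNset ?mulr0//].
    by split => //; exact/set_mem.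
  by move: yD; rewrite notin_setE => yD -[].
rewrite RintegralD//.
- by rewrite Rintegral_cst// addrK.
- exact: bmeas_integrable.
- by apply: bmeas_integrable => //; exact: bmeas_cst.
Qed.

Variable m1 : {sigma_finite_measure set T1 -> \bar R}.
Variable D1 : set T1.
Hypotheses (mD1 : measurable D1) (D1oo : (m1 D1 < +oo)%E).

Let g f (p : T1 * T2) := (f p * \1_(D1 `*` D2) p)%:E.

Let gE f : g f = (EFin \o f) \_ (D1 `*` D2).
Proof.
apply/funext => p; rewrite /g patchE indicE /=.
by case: ifP => _; rewrite (mulr1, mulr0).
Qed.

Let prod_fin : ((m1 \x m2)%E (D1 `*` D2) < +oo)%E.
Proof.
by rewrite product_measure1E// lte_mul_pinfty// ge0_fin_numE.
Qed.

Let ig f : bmeas f -> (m1 \x m2)%E.-integrable setT (g f).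
Proof.
move=> bf; rewrite gE; have mD : measurable (D1 `*` D2) by exact: measurableX.
apply/(integrable_mkcond _ mD).
by apply: bmeas_integrable => //; exact: measurableX.
Qed.

Let integral_section f x : bmeas f ->
  (\int[m2]_y g f (x, y) = (\1_D1 x * \int[m2]_(y in D2) f (x, y))%:E)%E.
Proof.
move=> bf; rewrite (_ : (fun y => _) =
    (fun y => ((EFin \o (fun y => \1_D1 x * f (x, y))) \_ D2) y)); last first.
  apply/funext => y; rewrite /g patchE !indicE /=.
  have -> : ((x, y) \in D1 `*` D2) = (x \in D1) && (y \in D2).
    by rewrite in_setX.
  by case: (x \in D1); case: (y \in D2) => /=; rewrite ?(mulr1, mulr0, mul1r, mul0r).
rewrite -integral_mkcond -(RintegralZl _ mD2); last first.
  by apply: bmeas_integrable => //; exact: bmeas_section1.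
rewrite /Rintegral fineK//; apply: integrable_fin_num => //.
apply: (@bmeas_integrable _ _ m2 D2 (fun y => \1_D1 x * f (x, y))) => //.
by apply: bmeasM; [exact: bmeas_cst|exact: bmeas_section1].
Qed.

Lemma Rintegral_prod12 f : bmeas f ->
  \int[m1]_(x in D1) (\int[m2]_(y in D2) f (x, y)) =
  \int[(m1 \x m2)%E]_(p in D1 `*` D2) f p.
Proof.
move=> bf; rewrite [RHS]/Rintegral integral_mkcond -gE -integral12_prod_meas1; last exact: ig.
rewrite Rintegral_mkcond /Rintegral; congr fine.
apply: eq_integral => x _; rewrite /fubini_F integral_section//.
by rewrite patchE indicE; case: ifP => _; rewrite (mul1r, mul0r).
Qed.

Let integral_section2 f y : bmeas f ->
  (\int[m1]_x g f (x, y) = (\1_D2 y * \int[m1]_(x in D1) f (x, y))%:E)%E.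
Proof.
move=> bf; rewrite (_ : (fun x => _) =
    (fun x => ((EFin \o (fun x => \1_D2 y * f (x, y))) \_ D1) x)); last first.
  apply/funext => x; rewrite /g patchE !indicE /=.
  have -> : ((x, y) \in D1 `*` D2) = (x \in D1) && (y \in D2).
    by rewrite in_setX.
  by case: (x \in D1); case: (y \in D2) => /=; rewrite ?(mulr1, mulr0, mul1r, mul0r).
rewrite -integral_mkcond -(RintegralZl _ mD1); last first.
  by apply: bmeas_integrable => //; exact: bmeas_section2.
rewrite /Rintegral fineK//; apply: integrable_fin_num => //.
apply: (@bmeas_integrable _ _ m1 D1 (fun x => \1_D2 y * f (x, y))) => //.
by apply: bmeasM; [exact: bmeas_cst|exact: bmeas_section2].
Qed.

Lemma Rintegral_prod21 f : bmeas f ->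
  \int[m2]_(y in D2) (\int[m1]_(x in D1) f (x, y)) =
  \int[(m1 \x m2)%E]_(p in D1 `*` D2) f p.
Proof.
move=> bf; rewrite [RHS]/Rintegral integral_mkcond -gE.
rewrite -integral21_prod_meas1; last exact: ig.
rewrite Rintegral_mkcond /Rintegral; congr fine.
apply: eq_integral => y _; rewrite /fubini_G integral_section2//.
by rewrite patchE indicE; case: ifP => _; rewrite (mul1r, mul0r).
Qed.

Lemma Rintegral_swap f : bmeas f ->
  \int[m1]_(x in D1) (\int[m2]_(y in D2) f (x, y)) =
  \int[m2]_(y in D2) (\int[m1]_(x in D1) f (x, y)).
Proof. by move=> bf; rewrite Rintegral_prod12// Rintegral_prod21. Qed.

End fubini_bounded.
End bounded_measurable.

(** * Means over the unit interval and the unit cube *)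

Section interval_means.
Context {R : realType}.
Local Notation RT := (measurableTypeR R).

Definition mean (f : R -> R) : R :=
  \int[@lebesgue_measure R]_(x in `[0, 1]) f x.

Let I01 : set RT := `[0, 1]%classic.

Let m01 : measurable I01. Proof. exact: measurable_itv. Qed.

Let mu01 : @lebesgue_measure R I01 = 1%E.
Proof. by rewrite lebesgue_measure_itv/= lte_fin ltr01 sube0. Qed.

Let fin01 : (@lebesgue_measure R I01 < +oo)%E.
Proof. by rewrite mu01 ltry. Qed.

Let bI (f : RT -> R) : bmeas f ->
  (@lebesgue_measure R).-integrable I01 (EFin \o f).
Proof. exact: bmeas_integrable. Qed.

Lemma eq_mean (f g : R -> R) :
  (forall x, 0 <= x <= 1 -> f x = g x) -> mean f = mean g.
Proof.
by move=> fg; apply: eq_Rintegral => x; rewrite inE /= in_itv /=; exact: fg.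
Qed.

Lemma mean_cst c : mean (fun _ => c) = c.
Proof. by rewrite /mean Rintegral_cst// [X in fine X]mu01 /= mulr1. Qed.

Lemma meanD (f g : RT -> R) : bmeas f -> bmeas g ->
  mean (fun x => f x + g x) = mean f + mean g.
Proof. by move=> /bI bf /bI bg; rewrite /mean RintegralD. Qed.

Lemma meanB (f g : RT -> R) : bmeas f -> bmeas g ->
  mean (fun x => f x - g x) = mean f - mean g.
Proof. by move=> /bI bf /bI bg; rewrite /mean RintegralB. Qed.

Lemma meanZl c (f : RT -> R) : bmeas f ->
  mean (fun x => c * f x) = c * mean f.
Proof. by move=> /bI bf; rewrite /mean RintegralZl. Qed.

Lemma meanZr c (f : RT -> R) : bmeas f ->
  mean (fun x => f x * c) = mean f * c.
Proof. by move=> /bI bf; rewrite /mean RintegralZr. Qed.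

Lemma mean_sum I (s : seq I) (F : I -> RT -> R) :
  (forall i, bmeas (F i)) ->
  mean (fun x => \sum_(i <- s) F i x) = \sum_(i <- s) mean (F i).
Proof.
move=> bF; elim: s => [|i s IH].
  by under eq_mean do rewrite big_nil; rewrite mean_cst big_nil.
under eq_mean do rewrite big_cons.
by rewrite meanD// ?IH ?big_cons//; exact: bmeas_sum.
Qed.

Lemma le_mean (f g : RT -> R) : bmeas f -> bmeas g ->
  (forall x, 0 <= x <= 1 -> f x <= g x) -> mean f <= mean g.
Proof.
by move=> /bI bf /bI bg fg; apply: le_Rintegral.
Qed.

Lemma mean_ge0 (f : RT -> R) : (forall x, 0 <= x <= 1 -> 0 <= f x) ->
  0 <= mean f.
Proof.
by move=> f0; apply: Rintegral_ge0 => x; rewrite /= in_itv /=; exact: f0.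
Qed.

Lemma norm_mean_le M (f : RT -> R) : bmeas f ->
  (forall x, 0 <= x <= 1 -> `|f x| <= M) -> `|mean f| <= M.
Proof.
move=> bf fM; rewrite ler_norml -{1}(mean_cst (- M)) -{2}(mean_cst M).
by apply/andP; split; apply: le_mean => //; try exact: bmeas_cst;
  move=> x /fM; rewrite ler_norml => /andP[].
Qed.

Lemma bmeas_mean d (T : measurableType d) (f : T * RT -> R) : bmeas f ->
  bmeas (fun x => mean (fun y => f (x, y))).
Proof.
exact: (@bmeas_param _ _ _ _ _ (@lebesgue_measure R) _ m01 fin01 f).
Qed.

Lemma bmeas_swap d1 d2 (T1 : measurableType d1) (T2 : measurableType d2)
  (f : T1 * T2 -> R) : bmeas f -> bmeas (fun p : T2 * T1 => f (p.2, p.1)).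
Proof.
by move=> bf; apply: (bmeas_comp bf); apply/measurable_fun_pairP; split;
  [exact: measurable_snd|exact: measurable_fst].
Qed.

Lemma mean_swap (f : RT * RT -> R) : bmeas f ->
  mean (fun x => mean (fun y => f (x, y))) =
  mean (fun y => mean (fun x => f (x, y))).
Proof.
exact: (@Rintegral_swap _ _ _ _ _ (@lebesgue_measure R) _ m01 fin01
  (@lebesgue_measure R) _ m01 fin01 f).
Qed.

Lemma mean_prod (f : RT * RT -> R) : bmeas f ->
  mean (fun x => mean (fun y => f (x, y))) =
  \int[(lebesgue_measure \x lebesgue_measure)%E]_(p in @unit_square R) f p.
Proof.
exact: (@Rintegral_prod12 _ _ _ _ _ (@lebesgue_measure R) _ m01 fin01
  (@lebesgue_measure R) _ m01 fin01 f).
Qed.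

End interval_means.

Section cube_means.
Context {R : realType}.
Local Notation RT := (measurableTypeR R).

Fixpoint cube_mean n : (n.-tuple RT -> R) -> R :=
  match n with
  | 0 => fun f => f [tuple]
  | n'.+1 => fun f => mean (fun a => cube_mean (fun t => f [tuple of a :: t]))
  end.

Lemma eq_cube_mean n (f g : n.-tuple RT -> R) :
  (forall t, (forall i, 0 <= tnth t i <= 1) -> f t = g t) ->
  cube_mean f = cube_mean g.
Proof.
elim: n f g => [|n IH] f g fg /=; first by apply: fg; case.
apply: eq_mean => a a01; apply: IH => t t01; apply: fg => i.
by case: (unliftP ord0 i) => [j|] ->; rewrite ?tnthS ?tnth0.
Qed.

Lemma bmeas_cons n d (T : measurableType d) (f : n.+1.-tuple RT -> R)
    (g : T -> RT) (h : T -> n.-tuple RT) :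
  bmeas f -> measurable_fun setT g -> measurable_fun setT h ->
  bmeas (fun x => f [tuple of g x :: h x]).
Proof. by move=> bf mg mh; apply: (bmeas_comp bf); exact: measurable_cons. Qed.

Lemma bmeas_cube_mean n d (T : measurableType d) (f : T * n.-tuple RT -> R) :
  bmeas f -> bmeas (fun x => cube_mean (fun t => f (x, t))).
Proof.
elim: n d T f => [|n IH] d T f bf /=; first exact: bmeas_section2.
pose F (p : (T * RT)%type * n.-tuple RT) := f (p.1.1, [tuple of p.1.2 :: p.2]).
apply: (bmeas_mean (f := fun q : T * RT => cube_mean (fun t => F (q, t)))).
apply: IH; apply: (bmeas_comp bf); apply/measurable_fun_pairP; split.
  exact: (measurableT_comp measurable_fst measurable_fst).
apply: measurable_cons; last exact: measurable_snd.
exact: (measurableT_comp measurable_snd measurable_fst).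
Qed.

Lemma bmeas_head n (f : n.+1.-tuple RT -> R) (a : RT) :
  bmeas f -> bmeas (fun t : n.-tuple RT => f [tuple of a :: t]).
Proof. by move=> bf; apply: bmeas_cons. Qed.

Lemma bmeas_consp n (f : n.+1.-tuple RT -> R) :
  bmeas f -> bmeas (fun p : RT * n.-tuple RT => f [tuple of p.1 :: p.2]).
Proof.
by move=> bf; apply: bmeas_cons.
Qed.

Lemma bmeas_cube_mean_head n (f : n.+1.-tuple RT -> R) :
  bmeas f -> bmeas (fun a : RT => cube_mean (fun t => f [tuple of a :: t])).
Proof.
move=> /bmeas_consp bf.
exact: (bmeas_cube_mean (f := fun p : RT * n.-tuple RT => f [tuple of p.1 :: p.2])).
Qed.

Lemma cube_mean_cst n c : cube_mean (fun _ : n.-tuple RT => c) = c.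
Proof. by elim: n => [//|n IH] /=; rewrite IH mean_cst. Qed.

Lemma cube_meanD n (f g : n.-tuple RT -> R) : bmeas f -> bmeas g ->
  cube_mean (fun x => f x + g x) = cube_mean f + cube_mean g.
Proof.
elim: n f g => [//|n IH] f g bf bg /=.
rewrite -meanD; [|exact: bmeas_cube_mean_head..].
by apply: eq_mean => a _; rewrite IH//; exact: bmeas_head.
Qed.

Lemma cube_meanZl n c (f : n.-tuple RT -> R) : bmeas f ->
  cube_mean (fun x => c * f x) = c * cube_mean f.
Proof.
elim: n f => [//|n IH] f bf /=.
rewrite -meanZl; last exact: bmeas_cube_mean_head.
by apply: eq_mean => a _; rewrite IH//; exact: bmeas_head.
Qed.

Lemma cube_meanB n (f g : n.-tuple RT -> R) : bmeas f -> bmeas g ->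
  cube_mean (fun x => f x - g x) = cube_mean f - cube_mean g.
Proof.
move=> bf bg; rewrite -mulN1r -cube_meanZl// -cube_meanD//; last first.
  by apply: bmeasM => //; exact: bmeas_cst.
by apply: eq_cube_mean => t _; rewrite mulN1r.
Qed.

Lemma cube_mean_sum n I (s : seq I) (F : I -> n.-tuple RT -> R) :
  (forall i, bmeas (F i)) ->
  cube_mean (fun x => \sum_(i <- s) F i x) = \sum_(i <- s) cube_mean (F i).
Proof.
move=> bF; elim: s => [|i s IH].
  by under eq_cube_mean do rewrite big_nil; rewrite cube_mean_cst big_nil.
under eq_cube_mean do rewrite big_cons.
by rewrite cube_meanD// ?IH ?big_cons//; exact: bmeas_sum.
Qed.

Lemma cube_mean_mean n (f : RT * n.-tuple RT -> R) : bmeas f ->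
  mean (fun a => cube_mean (fun t => f (a, t))) =
  cube_mean (fun t => mean (fun a => f (a, t))).
Proof.
elim: n f => [//|n IH] f bf /=.
pose F (p : (RT * RT)%type * n.-tuple RT) := f (p.1.1, [tuple of p.1.2 :: p.2]).
have bF : bmeas F.
  apply: (bmeas_comp bf); apply/measurable_fun_pairP; split.
    exact: (measurableT_comp measurable_fst measurable_fst).
  apply: measurable_cons; last exact: measurable_snd.
  exact: (measurableT_comp measurable_snd measurable_fst).
rewrite (mean_swap (f := fun q : RT * RT => cube_mean (fun t => F (q, t)))); last first.
  exact: bmeas_cube_mean.
apply: eq_mean => b _.
apply: (IH (fun q : RT * n.-tuple RT => f (q.1, [tuple of b :: q.2]))).
apply: (bmeas_comp bf); apply/measurable_fun_pairP; split; first exact: measurable_fst.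
by apply: measurable_cons => //; exact: measurable_snd.
Qed.

Let measurable_cube n : measurable (@unit_cube R n).
Proof.
apply: (@measurable_box R n (fun _ => `[0, 1]%classic)) => i.
exact: measurable_itv.
Qed.

Let cube_fin n : (tuple_lebesgue_measure R n (@unit_cube R n) < +oo)%E.
Proof.
have := @tuple_lebesgue_measure_box R n (fun _ => `[0, 1]%classic).
rewrite (_ : [set x | _] = @unit_cube R n)// => ->; last first.
  by move=> i; exact: measurable_itv.
rewrite big1 ?ltry// => i _.
by rewrite lebesgue_measure_itv/= lte_fin ltr01 sube0.
Qed.

(** From here on the measure on tuples is only met through iterated means over
    the unit interval. *)
Lemma cube_mean_integral n (f : n.-tuple RT -> R) : bmeas f ->
  \int[tuple_lebesgue_measure R n]_(x in @unit_cube R n) f x = cube_mean f.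
Proof.
elim: n f => [|n IH] f bf.
  have mf : measurable_fun [set: 0.-tuple RT] (fun x => (f x)%:E).
    by apply/measurable_EFinP; exact: bf.1.
  rewrite /Rintegral /= integral_dirac//; last exact: measurable_funTS.
  rewrite diracE mem_set ?mul1e//; last by case.
  exact: measurable_cube.
have mI : measurable (`[0, 1]%classic : set RT) by exact: measurable_itv.
have fI : (@lebesgue_measure R `[0%R, 1%R] < +oo)%E.
  by rewrite lebesgue_measure_itv/= lte_fin ltr01 sube0 ltry.
rewrite (_ : cube_mean f = mean (fun a =>
    \int[tuple_lebesgue_measure R n]_(t in @unit_cube R n) f [tuple of a :: t])); last first.
  by apply: eq_mean => a _; rewrite IH//; exact: bmeas_head.
have bfp := bmeas_consp bf.
rewrite /mean (@Rintegral_prod12 _ _ _ _ _ (tuple_lebesgue_measure R n) _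
  (@measurable_cube n) (cube_fin n) (@lebesgue_measure R) _ mI fI
  (fun p : RT * n.-tuple RT => f [tuple of p.1 :: p.2]))//.
rewrite /Rintegral /= /lebesgue_cons; congr fine.
have preE : @cons_pair R n @^-1` @unit_cube R n.+1 =
    `[0, 1]%classic `*` @unit_cube R n.
  apply/seteqP; split => -[a t] /=.
    move=> at01; split; first by have := at01 ord0; rewrite tnth0.
    by move=> i; have := at01 (lift ord0 i); rewrite tnthS.
  move=> [a01 t01] i.
  by case: (unliftP ord0 i) => [j|] ->; rewrite ?tnthS ?tnth0.
have pfin : ((@lebesgue_measure R \x tuple_lebesgue_measure R n)%E
    (`[0%R, 1%R]%classic `*` @unit_cube R n) < +oo)%E.
  rewrite product_measure1E//; last exact: measurable_cube.
  apply: lte_mul_pinfty => //; last exact: cube_fin.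
  by rewrite ge0_fin_numE.
rewrite integral_pushforward.
- by rewrite preE.
- exact: measurable_cons_pair.
- by apply/measurable_EFinP; exact: bf.1.
- rewrite preE.
  apply: (@bmeas_integrable _ _ _ _ _ (fun p : RT * n.-tuple RT => f [tuple of p.1 :: p.2])) => //.
    exact: measurableX.
- exact: measurable_cube.
Qed.

End cube_means.

(** * Replacing a kernel by a weakly equal one *)

Section partial_mean.
Context {R : realType}.
Local Notation RT := (measurableTypeR R).

Definition upd n (t : n.-tuple RT) (i : 'I_n) (s : RT) : n.-tuple RT :=
  [tuple if k == i then s else tnth t k | k < n].

Lemma tnth_upd n (t : n.-tuple RT) i s k :
  tnth (upd t i s) k = if k == i then s else tnth t k.
Proof. by rewrite tnth_mktuple. Qed.

Lemma measurable_upd n i d (T : measurableType d) (f : T -> n.-tuple RT)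
    (g : T -> RT) : measurable_fun setT f -> measurable_fun setT g ->
  measurable_fun setT (fun x => upd (f x) i (g x)).
Proof.
move=> mf mg; apply/measurable_fun_tnthP => k.
rewrite (_ : _ \o _ = fun x => if k == i then g x else tnth (f x) k).
  case: (k == i) => //.
  exact: (measurableT_comp (measurable_tnth k) mf).
by apply/funext => x /=; rewrite tnth_upd.
Qed.

Lemma bmeas_updr n (f : n.-tuple RT -> R) t i :
  bmeas f -> bmeas (fun s => f (upd t i s)).
Proof. by move=> bf; apply: (bmeas_comp bf); apply: measurable_upd. Qed.

Lemma bmeas_mean_upd n (f : n.-tuple RT -> R) i :
  bmeas f -> bmeas (fun t => mean (fun s => f (upd t i s))).
Proof.
move=> bf; apply: (bmeas_mean (f := fun p => f (upd p.1 i p.2))).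
by apply: (bmeas_comp bf); apply: measurable_upd.
Qed.

Lemma upd_cons0 n a (t : n.-tuple RT) s :
  upd [tuple of a :: t] ord0 s = [tuple of s :: t].
Proof.
apply: eq_from_tnth => k; rewrite tnth_upd.
case: (unliftP ord0 k) => [j|] ->; first by rewrite !tnthS.
by rewrite eqxx tnth0.
Qed.

Lemma upd_consS n a (t : n.-tuple RT) j s :
  upd [tuple of a :: t] (lift ord0 j) s = [tuple of a :: upd t j s].
Proof.
apply: eq_from_tnth => k; rewrite tnth_upd.
case: (unliftP ord0 k) => [l|] ->; last by rewrite !tnth0.
by rewrite !tnthS tnth_upd (inj_eq lift_inj).
Qed.

Lemma cube_mean_upd n (f : n.-tuple RT -> R) i : bmeas f ->
  cube_mean f = cube_mean (fun t => mean (fun s => f (upd t i s))).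
Proof.
elim: n f i => [|n IH] f i bf; first by case: i.
case: (unliftP ord0 i) => [j|] -> /=.
  apply: eq_mean => a _; rewrite (IH _ j); last exact: bmeas_head.
  by apply: eq_cube_mean => t _; apply: eq_mean => s _; rewrite upd_consS.
rewrite (cube_mean_mean (f := fun p => f [tuple of p.1 :: p.2])); last exact: bmeas_consp.
rewrite -[LHS]mean_cst; apply: eq_mean => a _.
by apply: eq_cube_mean => t _; apply: eq_mean => s _; rewrite upd_cons0.
Qed.

Definition global_kernel (U : R -> R -> R) :=
  bmeas (fun p : RT * RT => U p.1 p.2) /\ forall x y, U x y = U y x.

Lemma global_kernel_comp (U : R -> R -> R) d (T : measurableType d) (f g : T -> RT) :
  global_kernel U -> measurable_fun setT f -> measurable_fun setT g ->
  bmeas (fun x => U (f x) (g x)).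
Proof.
move=> [bU _] mf mg; apply: (bmeas_comp (h := fun x => (f x, g x)) bU).
by apply/measurable_fun_pairP.
Qed.

Definition edge_prod n (U : R -> R -> R) (S : seq ('I_n * 'I_n)) (t : n.-tuple RT) : R :=
  \prod_(e <- S) U (tnth t e.1) (tnth t e.2).

Lemma bmeas_edge n U (e : 'I_n * 'I_n) : global_kernel U ->
  bmeas (fun t : n.-tuple RT => U (tnth t e.1) (tnth t e.2)).
Proof. by move=> nU; apply: global_kernel_comp => //; exact: measurable_tnth. Qed.

Lemma bmeas_edge_prod n U (S : seq ('I_n * 'I_n)) : global_kernel U -> bmeas (edge_prod U S).
Proof. by move=> nU; apply: bmeas_prod => e; exact: bmeas_edge. Qed.

(** For a kernel this amounts to vanishing almost everywhere, but no exceptional set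
    has to be carried through the coordinates of a cube. *)
Definition weakly_zero (D : R -> R -> R) := forall f g : RT -> R,
  bmeas f -> bmeas g -> mean (fun x => mean (fun y => D x y * (f x * g y))) = 0.

(** As a function of the coordinates i and j alone, H is a product of a function of
    each. *)
Definition separable n (i j : 'I_n) (H : n.-tuple RT -> R) :=
  forall t, exists h1 h2 : RT -> R, [/\ bmeas h1, bmeas h2 &
    forall s s', H (upd (upd t j s') i s) = h1 s * h2 s'].

Lemma separable_edge_prod n (i j : 'I_n) U (S : seq ('I_n * 'I_n)) : global_kernel U ->
  (i < j)%N -> (forall e, e \in S -> (e.1 < e.2)%N) -> (i, j) \notin S ->
  separable i j (edge_prod U S).
Proof.
move=> nU ij; elim: S => [|e S IH] lS ijS t.
  exists (fun _ => 1), (fun _ => 1); split; try exact: bmeas_cst.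
  by move=> s s'; rewrite /edge_prod big_nil mulr1.
have [||h1 [h2 [b1 b2 h12]]] := IH _ _ t.
- by move=> e' e'S; apply: lS; rewrite inE e'S orbT.
- by apply: contra ijS; rewrite inE => ->; rewrite orbT.
have le : (e.1 < e.2)%N by apply: lS; rewrite inE eqxx.
have ne : (e.1 != i) || (e.2 != j).
  rewrite -negb_and; apply: contra ijS => /andP[/eqP e1 /eqP e2].
  by rewrite inE -e1 -e2 -surjective_pairing eqxx.
(* An edge other than ij that touches i avoids j, since i < j. *)
have [ei|ei] := boolP ((e.1 == i) || (e.2 == i)).
  exists (fun s => U (tnth (upd t i s) e.1) (tnth (upd t i s) e.2) * h1 s), h2.
  split => //.
    by apply: bmeasM => //;
    exact: (@bmeas_updr _ (fun t => U (tnth t e.1) (tnth t e.2)) _ _ (bmeas_edge e nU)).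
  move=> s s'; rewrite /edge_prod big_cons -/(edge_prod U S _) h12 mulrA; congr (_ * _ * _).
  have ej1 : (e.1 == j) = false.
    apply/eqP => e1j; move: ei; rewrite e1j => /orP[]/eqP e2i.
      by move: ij; rewrite e2i ltnn.
    by move: le; rewrite e1j e2i ltnNge (ltnW ij).
  have ej2 : (e.2 == j) = false.
    apply/eqP => e2j; move: ne; rewrite e2j eqxx orbF => /negbTE ne.
    by move: ei; rewrite ne /= e2j => /eqP e2i; move: ij; rewrite e2i ltnn.
  by rewrite !tnth_upd ej1 ej2.
exists h1, (fun s => U (tnth (upd t j s) e.1) (tnth (upd t j s) e.2) * h2 s).
split => //.
  by apply: bmeasM => //;
    exact: (@bmeas_updr _ (fun t => U (tnth t e.1) (tnth t e.2)) _ _ (bmeas_edge e nU)).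
move=> s s'; rewrite /edge_prod big_cons -/(edge_prod U S _) h12 mulrCA; congr (_ * (_ * _)).
move: ei; rewrite negb_or => /andP[/negbTE e1 /negbTE e2].
by rewrite !(tnth_upd _ i) e1 e2.
Qed.

Lemma separableM n (i j : 'I_n) (H K : n.-tuple RT -> R) :
  separable i j H -> separable i j K -> separable i j (fun t => H t * K t).
Proof.
move=> sH sK t; have [h1 [h2 [b1 b2 h]]] := sH t.
have [k1 [k2 [c1 c2 k]]] := sK t.
exists (fun s => h1 s * k1 s), (fun s => h2 s * k2 s).
by split; [exact: bmeasM|exact: bmeasM|move=> s s'; rewrite h k mulrACA].
Qed.

(** Average over the coordinates i and j first: H is then of the form h1 * h2, the
    kind of function that D annihilates. *)
Lemma cube_mean_weakly_zero n (i j : 'I_n) D (H : n.-tuple RT -> R) :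
  global_kernel D -> weakly_zero D -> i != j -> bmeas H -> separable i j H ->
  cube_mean (fun t => D (tnth t i) (tnth t j) * H t) = 0.
Proof.
move=> nD D0 ij bH sH.
have bF : bmeas (fun t => D (tnth t i) (tnth t j) * H t).
  by apply: bmeasM => //; exact: (bmeas_edge (i, j)).
rewrite (cube_mean_upd i bF) (cube_mean_upd j (bmeas_mean_upd i bF)).
rewrite -[RHS](cube_mean_cst n); apply: eq_cube_mean => t _.
have [h1 [h2 [b1 b2 h12]]] := sH t.
rewrite -(D0 _ _ b2 b1).
apply: eq_mean => s' _; apply: eq_mean => s _.
rewrite h12 !tnth_upd !eqxx eq_sym (negbTE ij) nD.2.
by rewrite (mulrC (h1 s)).
Qed.

Lemma global_kernelB U V : global_kernel U -> global_kernel V ->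
  global_kernel (fun x y => U x y - V x y).
Proof.
move=> [bU sU] [bV sV]; split; first exact: bmeasB.
by move=> x y; rewrite sU sV.
Qed.

(** Telescoping over the edges. A simple graph has no other edge joining the ends of
    the one that changes, so the remaining factors are separable there. *)
Lemma cube_mean_edge_prod_weak n U V (S : seq ('I_n * 'I_n)) : global_kernel U -> global_kernel V ->
  weakly_zero (fun x y => U x y - V x y) ->
  uniq S -> (forall e, e \in S -> (e.1 < e.2)%N) ->
  cube_mean (edge_prod U S) = cube_mean (edge_prod V S).
Proof.
move=> nU nV UV uS lS.
suff main (S1 S2 : seq ('I_n * 'I_n)) : uniq (S1 ++ S2) -> (forall e, e \in S1 ++ S2 -> (e.1 < e.2)%N) ->
    cube_mean (fun t => edge_prod U S1 t * edge_prod V S2 t) =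
    cube_mean (fun t => edge_prod V S1 t * edge_prod V S2 t).
  have e0 W : cube_mean (edge_prod W S) = cube_mean (fun t => edge_prod W S t * edge_prod V [::] t).
    by apply: eq_cube_mean => t _; rewrite /edge_prod big_nil mulr1.
  by rewrite (e0 U) (e0 V) main ?cats0.
elim: S1 S2 => [|e S1 IH] S2.
  by move=> _ _; apply: eq_cube_mean => t _; rewrite /edge_prod !big_nil.
move=> /= /andP[eS u12] l12.
have le : (e.1 < e.2)%N by apply: l12; rewrite inE eqxx.
have l12' e' : e' \in S1 ++ S2 -> (e'.1 < e'.2)%N.
  by move=> e'S; apply: l12; rewrite inE e'S orbT.
have ns1 : separable e.1 e.2 (edge_prod U S1).
  apply: separable_edge_prod => //.
    by move=> e' e'S; apply: l12'; rewrite mem_cat e'S.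
  by apply: contra eS; rewrite mem_cat -surjective_pairing => ->.
have ns2 : separable e.1 e.2 (edge_prod V S2).
  apply: separable_edge_prod => //.
    by move=> e' e'S; apply: l12'; rewrite mem_cat e'S orbT.
  by apply: contra eS; rewrite mem_cat -surjective_pairing => ->; rewrite orbT.
have bS : bmeas (fun t => edge_prod U S1 t * edge_prod V S2 t).
  by apply: bmeasM; exact: bmeas_edge_prod.
have e0 : cube_mean (fun t => edge_prod U (e :: S1) t * edge_prod V S2 t) =
    cube_mean (fun t => edge_prod U S1 t * edge_prod V (e :: S2) t).
  apply/eqP; rewrite -subr_eq0; apply/eqP; rewrite -cube_meanB; last 2 first.
  - by apply: bmeasM; exact: bmeas_edge_prod.
  - by apply: bmeasM; exact: bmeas_edge_prod.
  have ne : e.1 != e.2 by rewrite neq_ltn le.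
  rewrite -(cube_mean_weakly_zero (global_kernelB nU nV) UV ne bS (separableM ns1 ns2)).
  by apply: eq_cube_mean => t _; rewrite /edge_prod !big_cons; ring.
rewrite e0 IH.
- by apply: eq_cube_mean => t _; rewrite /edge_prod !big_cons mulrCA mulrA.
- move: eS u12; rewrite mem_cat negb_or => /andP[e1 e2].
  rewrite !cat_uniq /= => /and3P[-> h ->]; rewrite (negbTE e1) /= e2 andbT.
  by rewrite andbT.
- move=> e'; rewrite mem_cat inE => /orP[e'S|/orP[/eqP->//|e'S]].
    by apply: l12'; rewrite mem_cat e'S.
  by apply: l12'; rewrite mem_cat e'S orbT.
Qed.
End partial_mean.

(** * Functionals determined by finitely many densities *)

Section densities.
Context {R : realType}.
Local Notation RT := (measurableTypeR R).

Section graph_of_edges.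
Variables (n : nat) (S : seq ('I_n * 'I_n)).

Definition edges_rel : rel 'I_n :=
  fun i j => (i != j) && (((i, j) \in S) || ((j, i) \in S)).

Lemma edges_rel_sym : symmetric edges_rel.
Proof. by move=> i j; rewrite /edges_rel eq_sym orbC. Qed.

Lemma edges_rel_irr : irreflexive edges_rel.
Proof. by move=> i; rewrite /edges_rel eqxx. Qed.

Definition edges_graph := SGraph edges_rel_sym edges_rel_irr.
End graph_of_edges.

Lemma hom_density_cube_mean F (U : R -> R -> R) : global_kernel U ->
  hom_density F U = cube_mean (fun t => \prod_(ij : 'I_(gorder F) * 'I_(gorder F) |
    (ij.1 < ij.2)%N && gedge ij.1 ij.2) U (tnth t ij.1) (tnth t ij.2)).
Proof.
move=> nU; rewrite -cube_mean_integral//.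
under eq_fun => t do rewrite -big_filter.
by apply: bmeas_prod => e; exact: bmeas_edge.
Qed.

Lemma hom_density_edge_prod F (U : R -> R -> R) : global_kernel U ->
  hom_density F U = cube_mean (edge_prod U (enum [pred ij : 'I_(gorder F) * 'I_(gorder F) |
    (ij.1 < ij.2)%N && gedge ij.1 ij.2])).
Proof.
move=> nU; rewrite hom_density_cube_mean//; apply: eq_cube_mean => t _.
by rewrite /edge_prod big_enum_cond /=; apply: eq_bigl => ij; rewrite andbT.
Qed.

Lemma cube_mean_edge_prod_hom n (S : seq ('I_n * 'I_n)) (U : R -> R -> R) : global_kernel U ->
  uniq S -> (forall e, e \in S -> (e.1 < e.2)%N) ->
  cube_mean (edge_prod U S) = hom_density (edges_graph S) U.
Proof.
move=> nU uS lS; rewrite hom_density_cube_mean//; apply: eq_cube_mean => t _.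
rewrite /edge_prod big_uniq//=; apply: eq_bigl => -[i j] /=.
rewrite /edges_rel; apply/idP/idP => [ijS|].
  by rewrite ijS (lS _ ijS) /= andbT neq_ltn (lS _ ijS).
move=> /andP[ij /andP[_ /orP[//|jiS]]].
by have := lS _ jiS; rewrite /= ltnNge (ltnW ij).
Qed.

Definition graph_determined (Phi : (R -> R -> R) -> R) := exists (m : nat)
  (F : 'I_m -> sgraph), forall U V, global_kernel U -> global_kernel V ->
    (forall i, hom_density (F i) U = hom_density (F i) V) -> Phi U = Phi V.

Lemma graph_determined_pair Phi Psi Th : graph_determined Phi ->
  graph_determined Psi ->
  (forall U V, global_kernel U -> global_kernel V -> Phi U = Phi V -> Psi U = Psi V -> Th U = Th V) ->
  graph_determined Th.
Proof.
move=> [m [F HF]] [m' [F' HF']] H.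
exists (m + m')%N, (fun i : 'I_(m + m') => match fintype.split i with inl j => F j | inr j => F' j end).
move=> U V nU nV UV; apply: H => //; [apply: HF|apply: HF'] => // i.
  by have := UV (lshift m' i); rewrite (unsplitK (inl i)).
by have := UV (rshift m i); rewrite (unsplitK (inr i)).
Qed.

Lemma graph_determined_cst Phi : (forall U V, global_kernel U -> global_kernel V -> Phi U = Phi V) ->
  graph_determined Phi.
Proof. by move=> H; exists 0%N, (fun _ => edges_graph (n := 0) [::]) => U V nU nV _; exact: H. Qed.

Definition deg (U : R -> R -> R) (x : R) : R := mean (fun y => U x y).

Lemma bmeas_deg U : global_kernel U -> bmeas (deg U : RT -> R).
Proof. by move=> [bU _]; exact: bmeas_mean bU. Qed.

Definition deg_prod n U (D : seq 'I_n) (t : n.-tuple RT) : R :=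
  \prod_(i <- D) deg U (tnth t i).

Lemma bmeas_deg_prod n U (D : seq 'I_n) : global_kernel U -> bmeas (deg_prod U D).
Proof.
move=> nU; apply: bmeas_prod => i.
exact: (bmeas_comp (bmeas_deg nU) (measurable_tnth i)).
Qed.

(** Unfolding a factor deg U (x_i) into its integral adds a pendant vertex at i. The
    new vertex comes first, so that its edge is increasing, and the graph stays
    simple because the vertex is new. *)
Lemma graph_determined_mono n (D : seq 'I_n) (S : seq ('I_n * 'I_n)) :
  uniq S -> (forall e, e \in S -> (e.1 < e.2)%N) ->
  graph_determined (fun U => cube_mean (fun t => deg_prod U D t * edge_prod U S t)).
Proof.
move Ek : (size D) => k; elim: k n D S Ek => [|k IH] n [|i D] S //= Ek uS lS.
  exists 1%N, (fun _ => edges_graph S) => U V nU nV /(_ ord0).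
  rewrite -!cube_mean_edge_prod_hom// => UV.
  have e0 W : cube_mean (fun t => deg_prod W [::] t * edge_prod W S t) = cube_mean (edge_prod W S).
    by apply: eq_cube_mean => t _; rewrite /deg_prod big_nil mul1r.
  by rewrite !e0.
move: Ek => [Ek].
pose l := @lift n.+1 ord0.
pose S' := (ord0, l i) :: [seq (l e.1, l e.2) | e <- S].
have [|||m [F HF]] := IH n.+1 [seq l j | j <- D] S'.
- by rewrite size_map.
- rewrite /= map_inj_uniq ?uS ?andbT; last first.
    move=> [a b] [c d] /= e0; congr pair; apply: (@lift_inj _ ord0).
      exact: (congr1 fst e0).
    exact: (congr1 snd e0).
  apply/mapP => -[[a b] _ /= e0].
  by have /eqP := congr1 fst e0; rewrite (negbTE (neq_lift _ _)).
- by move=> e; rewrite inE => /orP[/eqP->//|/mapP[e' /lS le ->]] /=.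
have main U : global_kernel U ->
    cube_mean (fun t => deg_prod U (i :: D) t * edge_prod U S t) =
    cube_mean (fun t => deg_prod U [seq l j | j <- D] t * edge_prod U S' t).
  move=> nU /=.
  (* The integrand of the enlarged graph, with the new vertex as first component. *)
  pose f (p : RT * n.-tuple RT) :=
    deg_prod U [seq l j | j <- D] [tuple of p.1 :: p.2] * edge_prod U S' [tuple of p.1 :: p.2].
  have bf : bmeas f.
    apply: (bmeas_consp (f := fun t => deg_prod U [seq l j | j <- D] t * edge_prod U S' t)).
    by apply: bmeasM; [exact: bmeas_deg_prod|exact: bmeas_edge_prod].
  rewrite (cube_mean_mean bf); apply: eq_cube_mean => t _.
  rewrite /f /deg_prod /edge_prod /S' big_cons.
  under [RHS]eq_mean => a _.
    rewrite big_map big_cons big_map /= tnth0 tnthS.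
    under eq_bigr => j _ do rewrite tnthS.
    under [X in _ * (_ * X)]eq_bigr => e _ do rewrite !tnthS.
    rewrite mulrCA nU.2.
    over.
  rewrite /= meanZr ?mulrA//.
  by apply: global_kernel_comp => //; exact: measurable_cst.
by exists m, F => U V nU nV UV; rewrite !main//; exact: HF.
Qed.

(** Polynomials in the degrees and the edge values which are of degree at most one in
    every edge: densities of simple graphs can only integrate those. For the same
    reason a product below requires disjoint sets of edges. *)
Definition graph_poly n (E : seq ('I_n * 'I_n))
    (g : (R -> R -> R) -> n.-tuple RT -> R) :=
  exists s : seq (R * seq 'I_n * seq ('I_n * 'I_n)),
    (forall m, m \in s -> uniq m.2 /\ {subset m.2 <= E}) /\
    forall U t, g U t = \sum_(m <- s) m.1.1 * (deg_prod U m.1.2 t * edge_prod U m.2 t).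

Section graph_poly_theory.
Variable n : nat.
Implicit Types E : seq ('I_n * 'I_n).

Lemma graph_poly_sub E E' g : {subset E <= E'} -> graph_poly E g -> graph_poly E' g.
Proof.
move=> EE' [s [sE gE]]; exists s; split => // m /sE [um mE]; split => //.
by move=> e /mE /EE'.
Qed.

Lemma graph_poly_cst c : graph_poly [::] (fun _ (_ : n.-tuple RT) => c).
Proof.
exists [:: (c, [::], [::])]; split.
  by move=> m; rewrite inE => /eqP ->; split.
by move=> U t; rewrite big_seq1 /deg_prod /edge_prod /= !big_nil !mulr1.
Qed.

Lemma graph_poly_deg i : graph_poly [::] (fun U (t : n.-tuple RT) => deg U (tnth t i)).
Proof.
exists [:: (1, [:: i], [::])]; split.
  by move=> m; rewrite inE => /eqP ->; split.
by move=> U t; rewrite big_seq1 /deg_prod /edge_prod /= big_nil big_seq1 mul1r mulr1.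
Qed.

Lemma graph_poly_edge i j :
  graph_poly [:: (i, j)] (fun U (t : n.-tuple RT) => U (tnth t i) (tnth t j)).
Proof.
exists [:: (1, [::], [:: (i, j)])]; split.
  by move=> m; rewrite inE => /eqP ->; split.
by move=> U t; rewrite big_seq1 /deg_prod /edge_prod /= big_nil big_seq1 !mul1r.
Qed.

Lemma graph_polyD E g h : graph_poly E g -> graph_poly E h ->
  graph_poly E (fun U t => g U t + h U t).
Proof.
move=> [s [sE gE]] [s' [sE' hE]]; exists (s ++ s'); split.
  by move=> m; rewrite mem_cat => /orP[/sE|/sE'].
by move=> U t; rewrite big_cat /= -gE -hE.
Qed.

Lemma graph_polyM E E' g h : uniq (E ++ E') -> graph_poly E g -> graph_poly E' h ->
  graph_poly (E ++ E') (fun U t => g U t * h U t).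
Proof.
rewrite cat_uniq => /and3P[_ /hasPn EE' _] [s [sE gE]] [s' [sE' hE]].
exists [seq (m.1.1 * m'.1.1, m.1.2 ++ m'.1.2, m.2 ++ m'.2) | m <- s, m' <- s'].
split.
  move=> _ /allpairsP [[m m'] /= [/sE [um mE] /sE' [um' mE'] ->]] /=; split.
    rewrite cat_uniq um um' andbT /=; apply/hasPn => e /mE' /EE' /=.
    by apply: contra => /mE.
  by move=> e; rewrite !mem_cat => /orP[/mE ->//|/mE' ->]; rewrite orbT.
move=> U t; rewrite gE hE big_allpairs_dep /= mulr_suml; apply: eq_bigr => m _.
rewrite mulr_sumr; apply: eq_bigr => m' _.
by rewrite /deg_prod /edge_prod !big_cat /=; ring.
Qed.

Lemma graph_polyMl E g h : uniq E -> graph_poly [::] g -> graph_poly E h ->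
  graph_poly E (fun U t => g U t * h U t).
Proof. exact: (@graph_polyM [::]). Qed.

Lemma graph_polyZ E c g : uniq E -> graph_poly E g ->
  graph_poly E (fun U t => c * g U t).
Proof. by move=> uE; apply: graph_polyMl => //; exact: graph_poly_cst. Qed.

Lemma graph_determined_poly E g : graph_poly E g ->
  (forall e, e \in E -> (e.1 < e.2)%N) ->
  graph_determined (fun U => cube_mean (g U)).
Proof.
move=> [s [sE gE]] lE.
have bm U m : global_kernel U -> bmeas (fun t => m.1.1 * (deg_prod U m.1.2 t * edge_prod U m.2 t)).
  move=> nU; apply: bmeasM; first exact: bmeas_cst.
  by apply: bmeasM; [exact: bmeas_deg_prod|exact: bmeas_edge_prod].
have main U : global_kernel U -> cube_mean (g U) =
    \sum_(m <- s) m.1.1 * cube_mean (fun t => deg_prod U m.1.2 t * edge_prod U m.2 t).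
  move=> nU; transitivity (cube_mean (fun t =>
      \sum_(m <- s) m.1.1 * (deg_prod U m.1.2 t * edge_prod U m.2 t))).
    by apply: eq_cube_mean => t _; rewrite gE.
  rewrite cube_mean_sum; last by move=> m; exact: bm.
  apply: eq_bigr => m _; rewrite cube_meanZl//.
  by apply: bmeasM; [exact: bmeas_deg_prod|exact: bmeas_edge_prod].
suff [m [F HF]] : graph_determined (fun U =>
    \sum_(m <- s) m.1.1 * cube_mean (fun t => deg_prod U m.1.2 t * edge_prod U m.2 t)).
  by exists m, F => U V nU nV UV; rewrite !main//; exact: HF.
have {}sE m : m \in s -> uniq m.2 /\ (forall e, e \in m.2 -> (e.1 < e.2)%N).
  by move=> /sE [um mE]; split => // e /mE /lE.
elim: s sE {gE bm main} => [|m s IH] sE.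
  by apply: graph_determined_cst => U V _ _; rewrite !big_nil.
have [um lm] := sE m (mem_head _ _).
apply: (graph_determined_pair (graph_determined_mono m.1.2 um lm)).
  by apply: IH => m' m's; apply: sE; rewrite inE m's orbT.
by move=> U V nU nV /= e1 e2; rewrite !big_cons e1 e2.
Qed.
End graph_poly_theory.
End densities.

(** * Chebyshev polynomials and the Poisson kernel *)

Section chebyshev.
Context {R : realType}.
Local Notation RT := (measurableTypeR R).
Implicit Types u v t : R.

(** The Chebyshev polynomial T_n, evaluated at u. *)
Fixpoint cheb n u : R :=
  if n is n'.+1 then
    if n' is n''.+1 then 2 * u * cheb n' u - cheb n'' u else u
  else 1.

Lemma chebSS n u : cheb n.+2 u = 2 * u * cheb n.+1 u - cheb n u.
Proof. by []. Qed.

Lemma nat_ind2 (P : nat -> Prop) : P 0%N -> P 1%N ->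
  (forall n, P n -> P n.+1 -> P n.+2) -> forall n, P n.
Proof.
move=> P0 P1 PS n; suff : P n /\ P n.+1 by case.
by elim: n => [//|n [Pn PSn]]; split => //; exact: PS.
Qed.

Lemma cheb_cos n t : cheb n (cos t) = cos (n%:R * t).
Proof.
elim/nat_ind2: n => [||n IH IH1]; first by rewrite mul0r cos0.
  by rewrite mul1r.
rewrite chebSS IH IH1.
have -> : n.+2%:R * t = n.+1%:R * t + t by rewrite -[n.+2]addn1 natrD mulrDl mul1r.
have -> : n%:R * t = n.+1%:R * t - t by rewrite -[n.+1]addn1 natrD mulrDl mul1r addrK.
by rewrite cosB cosD; ring.
Qed.

Lemma cheb_le1 n u : `|u| <= 1 -> `|cheb n u| <= 1.
Proof.
rewrite ler_norml => /andP[u1 u2].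
rewrite -(@acosK _ u) ?in_itv/= ?u1// cheb_cos ler_norml.
by rewrite cos_geN1 cos_le1.
Qed.

Lemma mul_cheb n u : u * cheb n.+1 u = (cheb n.+2 u + cheb n u) / 2.
Proof. by rewrite chebSS; field. Qed.

Lemma bmeas_cheb d (T : measurableType d) n (q : T -> R) : bmeas q ->
  bmeas (fun x => cheb n (q x)).
Proof.
move=> bq; elim/nat_ind2: n => [|//|n IH IH1]; first exact: bmeas_cst.
apply: bmeasB => //; apply: bmeasM => //; apply: bmeasM => //; exact: bmeas_cst.
Qed.
End chebyshev.

(** The kernel E(u,v) = sum_n l^n T_n(u) T_n(v) is the average of two Poisson
    kernels, hence the quotient of two polynomials. *)
Section poisson.
Context {R : realType}.
Local Notation RT := (measurableTypeR R).
Variable l : R.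
Hypotheses (l0 : 0 < l) (l1 : l <= 1 / 128).
Implicit Types u v : R.

Definition pden u v : R :=
  (1 + l ^+ 2) ^+ 2 - 4 * l * (1 + l ^+ 2) * u * v +
  4 * l ^+ 2 * (u ^+ 2 + v ^+ 2 - 1).

Definition pnum u v : R :=
  pden u v / 2 + (1 - l ^+ 2) / 2 * (1 + l ^+ 2 - 2 * l * u * v).

Definition poisson u v : R := pnum u v / pden u v.

Definition pterm n u v : R := l ^+ n * cheb n u * cheb n v.

Definition ppart n u v : R := \sum_(k < n) pterm k u v.

(** [pterm] is a combination of n-th powers of l exp(+-i(alpha +- beta)), where
    u = cos alpha and v = cos beta, so it satisfies a linear recurrence of order
    four. The sum of its coefficients is [pden], and the [pcoef] are their partial
    sums, which appear when the recurrence is summed over n. *)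
Definition pcoef1 u v : R := 1 - 4 * l * u * v.
Definition pcoef2 u v : R :=
  pcoef1 u v + 2 * l ^+ 2 + 4 * l ^+ 2 * (u ^+ 2 + v ^+ 2 - 1).
Definition pcoef3 u v : R := pcoef2 u v - 4 * l ^+ 3 * u * v.

Definition ppart_rem n u v : R := pterm n.+3 u v + pcoef1 u v * pterm n.+2 u v +
  pcoef2 u v * pterm n.+1 u v + pcoef3 u v * pterm n u v.

(** Summed recurrence: multiplying the partial sum by pden makes it telescope. At
    n = 0 the remainder is pnum, which gives the closed form pnum / pden. *)
Lemma pden_ppart n u v : pden u v * ppart n u v = pnum u v - ppart_rem n u v.
Proof.
elim: n => [|n IH].
  by rewrite /ppart big_ord0 /ppart_rem /pterm /pnum /pden /pcoef3 /pcoef2 /pcoef1 !chebSS /=; field.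
rewrite /ppart big_ord_recr /= -/(ppart n u v) mulrDr IH.
rewrite /ppart_rem /pterm /pden /pcoef3 /pcoef2 /pcoef1 !chebSS !exprS; ring.
Qed.

Lemma pden_ge u v : `|u| <= 1 -> `|v| <= 1 -> 1 / 2 <= pden u v.
Proof.
have [L0 L1] := (l0, l1).
rewrite !ler_norml => /andP[u1 u2] /andP[v1 v2].
have uv : u * v <= 1 by nra.
have k : 4 * l * (1 + l ^+ 2) * u * v <= 4 * l * (1 + l ^+ 2).
  by rewrite -mulrA ler_piMr//; apply: mulr_ge0; nra.
have : 0 <= 4 * l ^+ 2 * (u ^+ 2 + v ^+ 2).
  by rewrite mulr_ge0// ?addr_ge0 ?sqr_ge0// mulr_ge0// sqr_ge0.
have l2 : 0 <= l ^+ 2 <= 1 / 128 * l by rewrite sqr_ge0 expr2 ler_wpM2r// ltW.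
have l3 : l * l ^+ 2 <= 1 / 128 * l by rewrite mulrC ler_wpM2r//; lra.
have := sqr_ge0 (l ^+ 2).
rewrite /pden; lra.
Qed.

Lemma pden_gt0 u v : `|u| <= 1 -> `|v| <= 1 -> 0 < pden u v.
Proof. by move=> u1 v1; apply: lt_le_trans (pden_ge u1 v1); lra. Qed.

Lemma pterm_le n u v : `|u| <= 1 -> `|v| <= 1 -> `|pterm n u v| <= l ^+ n.
Proof.
move=> /(cheb_le1 n) u1 /(cheb_le1 n) v1; rewrite /pterm !normrM normrX.
rewrite (gtr0_norm l0) -mulrA; apply: ler_piMr; first by rewrite exprn_ge0// ltW.
exact: mulr_ile1.
Qed.

(** The recurrence leaves a remainder of at most 5 l^n, and pden >= 1/2. *)
Lemma poisson_ppart n u v : `|u| <= 1 -> `|v| <= 1 ->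
  `|poisson u v - ppart n u v| <= 10 * l ^+ n.
Proof.
have [L0 L1] := (l0, l1).
move=> u1 v1; have Q0 := pden_gt0 u1 v1.
have -> : poisson u v - ppart n u v = ppart_rem n u v / pden u v.
  have -> : ppart n u v = (pnum u v - ppart_rem n u v) / pden u v.
    by rewrite -pden_ppart mulrC mulKf// gt_eqF.
  by rewrite /poisson -mulrBl opprB addrC subrK.
rewrite normrM normfV (gtr0_norm Q0) ler_pdivrMr//.
have ln0 : 0 <= l ^+ n by rewrite exprn_ge0// ltW.
apply: (@le_trans _ _ (5 * l ^+ n)); last first.
  have := pden_ge u1 v1; nra.
have pS m : `|pterm (m + n) u v| <= l ^+ n.
  apply: (le_trans (pterm_le _ u1 v1)); rewrite exprD ler_piMl//.
  rewrite exprn_ile1 ?ltW//; lra.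
have uv1 : `|u * v| <= 1 by rewrite normrM mulr_ile1.
have u2 : 0 <= u ^+ 2 <= 1 by rewrite sqr_ge0 -real_normK ?num_real// exprn_ile1.
have v2 : 0 <= v ^+ 2 <= 1 by rewrite sqr_ge0 -real_normK ?num_real// exprn_ile1.
have l2 : 0 <= l ^+ 2 <= 1 / 128 * l by rewrite sqr_ge0 expr2 ler_wpM2r// ltW.
have l3 : 0 <= l ^+ 3 <= 1 / 128 * l ^+ 2.
  apply/andP; split; first by rewrite exprn_ge0// ltW.
  by rewrite exprS ler_wpM2r// sqr_ge0.
have q1 : `|pcoef1 u v| <= 17 / 16.
  rewrite ler_norml /pcoef1 -!mulrA; move: uv1; rewrite ler_norml => /andP[a b].
  by apply/andP; split; nra.
have q2 : `|pcoef2 u v| <= 18 / 16.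
  move: q1; rewrite !ler_norml /pcoef2 => /andP[a b].
  by apply/andP; split; nra.
have q3 : `|pcoef3 u v| <= 5 / 4.
  move: q2 uv1; rewrite !ler_norml /pcoef3 -!mulrA => /andP[a b] /andP[c d].
  by apply/andP; split; nra.
have pM k q m : `|q| <= k -> `|q * pterm (m + n) u v| <= k * l ^+ n.
  by move=> qk; rewrite normrM ler_pM.
have norm4 (a b c d : R) : `|a + b + c + d| <= `|a| + `|b| + `|c| + `|d|.
  rewrite (le_trans (ler_normD _ _))// lerD2r.
  by rewrite (le_trans (ler_normD _ _))// lerD2r ler_normD.
rewrite /ppart_rem; apply: (le_trans (norm4 _ _ _ _)).
have := pS 3%N; have := pM _ _ 2%N q1; have := pM _ _ 1%N q2; have := pM _ _ 0%N q3.
rewrite /= !addSn add0n; lra.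
Qed.

Lemma small_geom e : 0 < e -> exists n, forall m, (n <= m)%N -> 10 * l ^+ m <= e.
Proof.
have [L0 L1] := (l0, l1); move=> e0.
have l1' : `|l| < 1 by rewrite gtr0_norm//; lra.
have e10 : 0 < e / 10 by rewrite divr_gt0.
have /cvgrPdist_le/(_ _ e10)[n _ Hn] := cvg_expr l1'.
exists n => m nm; have := Hn m nm; rewrite sub0r normrN ger0_norm.
  by rewrite ler_pdivlMr// mulrC.
by rewrite exprn_ge0// ltW.
Qed.

Lemma ppart_cvg u v : `|u| <= 1 -> `|v| <= 1 ->
  (fun n => ppart n u v) @ \oo --> poisson u v.
Proof.
move=> u1 v1; apply/cvgrPdist_le => e /small_geom [n Hn].
by exists n => // m nm; rewrite (le_trans (poisson_ppart m u1 v1))// Hn.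
Qed.

Lemma bmeas_ppart d (T : measurableType d) n (p q : T -> R) : bmeas p -> bmeas q ->
  bmeas (fun x => ppart n (p x) (q x)).
Proof.
move=> bp bq; apply: bmeas_sum => k; apply: bmeasM; last exact: bmeas_cheb.
by apply: bmeasM; [exact: bmeas_cst|exact: bmeas_cheb].
Qed.

Lemma poisson_le u v : `|u| <= 1 -> `|v| <= 1 -> `|poisson u v| <= 10.
Proof.
move=> u1 v1; have := poisson_ppart 0 u1 v1.
by rewrite /ppart big_ord0 subr0 expr0 mulr1.
Qed.

Lemma bmeas_poisson d (T : measurableType d) (p q : T -> R) : bmeas p -> bmeas q ->
  (forall x, `|p x| <= 1) -> (forall x, `|q x| <= 1) ->
  bmeas (fun x => poisson (p x) (q x)).
Proof.
move=> bp bq p1 q1; split; last by exists 10 => x; exact: poisson_le.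
apply/measurable_EFinP; apply: (emeasurable_fun_cvg
  (fun n x => (ppart n (p x) (q x))%:E)) => [n|x _].
  by apply/measurable_EFinP; exact: (bmeas_ppart n bp bq).1.
apply: cvg_EFin; first by exact: nearW.
exact: ppart_cvg.
Qed.

(** W_lambda in the coordinates u = cos (pi x), v = cos (pi y). *)
Definition wfun u v : R :=
  2^-1 + (u + v) / 8 + u * v / 16 + (poisson u v - 1 - l * u * v).

Lemma W_lambdaE x y : W_lambda l x y = wfun (cos (pi * x)) (cos (pi * y)).
Proof.
rewrite /W_lambda /wfun; congr (_ + _).
have c1 z : `|cos z| <= 1 by rewrite ler_norml cos_geN1 cos_le1.
apply/cvg_lim => //.
have c2 : (fun n => ppart n (cos (pi * x)) (cos (pi * y)) - 1 - l * cos (pi * x) * cos (pi * y))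
    @ \oo --> poisson (cos (pi * x)) (cos (pi * y)) - 1 - l * cos (pi * x) * cos (pi * y).
  apply: cvgB; last exact: cvg_cst.
  by apply: cvgB; [exact: ppart_cvg|exact: cvg_cst].
apply: cvg_trans c2; apply: near_eq_cvg.
exists 2%N => // n /= n2.
rewrite /ppart -(big_mkord xpredT (fun k => pterm k _ _)).
rewrite (@big_cat_nat _ _ _ 2%N)//= big_mkord big_ord_recr big_ord1 /=.
rewrite /pterm /= expr0 expr1 !mul1r.
rewrite [X in X - 1 - _](_ : _ = 1 + l * cos (pi * x) * cos (pi * y) +
  \sum_(2 <= n0 < n) l ^+ n0 * cos (n0%:R * pi * x) * cos (n0%:R * pi * y)).
  by ring.
congr (_ + _); apply: eq_bigr => k _.
by rewrite !cheb_cos !mulrA.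
Qed.
End poisson.

(** * Cosines in mean *)

Section cosine_means.
Context {R : realType}.
Local Notation RT := (measurableTypeR R).

Definition cpi (x : R) : R := cos (pi * x).

Lemma cpi_le1 x : `|cpi x| <= 1.
Proof. by rewrite ler_norml cos_geN1 cos_le1. Qed.

Lemma bmeas_cpi : bmeas (cpi : RT -> R).
Proof.
split; last by exists 1; exact: cpi_le1.
apply: continuous_measurable_fun => x; apply: continuous_comp.
  exact: mulrl_continuous.
exact: continuous_cos.
Qed.

Lemma is_derive_sin_scale (a x : R) :
  is_derive x (1 : R) (fun x : R => sin (a * x)) (a * cos (a * x)).
Proof.
have d1 : is_derive x (1 : R) (fun x : R => a * x) a.
  have := @is_deriveZ R _ _ id a x (1 : R) _ (is_derive_id _ _).
  by rewrite /GRing.scale /= mulr1.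
have := @is_derive1_comp R sin (fun x => a * x) x _ _ (is_derive_sin _) d1.
by rewrite /= mulrC.
Qed.

Lemma mean_cos n : (0 < n)%N -> mean (fun x : RT => cos (n%:R * (pi * x))) = 0.
Proof.
move=> n0; pose a : R := n%:R * pi.
have a0 : a != 0 by rewrite mulf_neq0// ?pnatr_eq0 -?lt0n// gt_eqF// pi_gt0.
have dF x := is_derive_sin_scale a x.
have cF x : {for x, continuous (fun x : R => sin (a * x))}.
  by apply: differentiable_continuous; apply/derivable1_diffP; case: (dF x).
have cf (x : R) : {for x, continuous (fun x : R => a * cos (a * x))}.
  apply: continuousM; first exact: cst_continuous.
  by apply: continuous_comp; [exact: mulrl_continuous|exact: continuous_cos].
have H := @continuous_FTC2 R (fun x : R => a * cos (a * x)) (fun x : R => sin (a * x)) 0 1 ltr01.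
have {}H : mean (fun x => a * cos (a * x)) = 0.
  rewrite /mean /Rintegral H.
  - rewrite mulr0 sin0 mulr1 /a.
    have -> : sin (n%:R * pi) = 0 :> R.
      elim: {+}n => [|m IH]; first by rewrite mul0r sin0.
      by rewrite -[m.+1]addn1 natrD mulrDl mul1r sinDpi IH oppr0.
    by rewrite subee.
  - by apply: continuous_subspaceT => x; exact: cf.
  - split.
    + by move=> x _; case: (dF x).
    + by apply: cvg_at_right_filter; exact: cF.
    + by apply: cvg_at_left_filter; exact: cF.
  - move=> x _; rewrite derive1E; case: (dF x) => _ //.
have bc : bmeas (fun x : RT => cos (a * x)).
  split; last by exists 1 => x; rewrite ler_norml cos_geN1 cos_le1.
  apply: continuous_measurable_fun => x; apply: continuous_comp.
    exact: mulrl_continuous.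
  exact: continuous_cos.
move: H; rewrite meanZl// => /eqP; rewrite mulf_eq0 (negbTE a0) /= => /eqP H.
by rewrite -[RHS]H; apply: eq_mean => x _; rewrite /a mulrA.
Qed.

Lemma bmeas_cheb_cpi n : bmeas (fun x : RT => cheb n (cpi x)).
Proof. exact: bmeas_cheb bmeas_cpi. Qed.

Lemma mean_cheb_cpi n : mean (fun x : RT => cheb n (cpi x)) = (n == 0%N)%:R.
Proof.
under eq_mean do rewrite cheb_cos.
case: n => [|n]; last by rewrite mean_cos.
by under eq_mean do rewrite mul0r cos0; rewrite mean_cst.
Qed.

(** The squared norm of T_n for the arcsine law. *)
Definition cheb_norm n : R := if n == 0%N then 1 else 2^-1.

Lemma mean_chebM_cpi n m :
  mean (fun x : RT => cheb n (cpi x) * cheb m (cpi x)) =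
  if n == m then cheb_norm n else 0.
Proof.
wlog nm : n m / (n <= m)%N => [H|].
  have [/H//|/ltnW /H] := leqP n m.
  rewrite eq_sym => e; under eq_mean do rewrite mulrC.
  by rewrite e; case: eqP => // ->.
rewrite (_ : mean _ = mean (fun x : RT =>
    2^-1 * (cheb (m - n) (cpi x) + cheb (m + n) (cpi x)))); last first.
  apply: eq_mean => x _; rewrite !cheb_cos natrB// natrD.
  by rewrite mulrBl (mulrDl m%:R) cosB cosD; field.
rewrite meanZl; last by apply: bmeasD; exact: bmeas_cheb_cpi.
rewrite meanD; [|exact: bmeas_cheb_cpi..].
rewrite !mean_cheb_cpi subn_eq0 addn_eq0 /cheb_norm.
have [->|ne] := eqVneq n m.
  rewrite leqnn; case: m {nm} => [|m] /=; first by field.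
  by rewrite addr0 mulr1.
rewrite leqNgt ltn_neqAle ne nm /=.
by case: n m ne {nm} => [|n] [|m] //= _; rewrite addr0 mulr0.
Qed.
End cosine_means.

Section poisson_means.
Context {R : realType}.
Local Notation RT := (measurableTypeR R).
Variable l : R.
Hypotheses (l0 : 0 < l) (l1 : l <= 1 / 128).

Definition eigval n : R := l ^+ n * cheb_norm n.

(** T_n is an eigenvector of the Poisson kernel: integrate the series termwise. *)
Lemma mean_poisson_cheb (u : R) n : `|u| <= 1 ->
  mean (fun y : RT => poisson l u (cpi y) * cheb n (cpi y)) = eigval n * cheb n u.
Proof.
move=> u1; apply/eqP; rewrite -subr_eq0 -normr_le0; apply/ler_addgt0Pr => e e0.
rewrite add0r; have [N HN] := small_geom l0 l1 e0.
pose m := maxn N n.+1.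
have bP : bmeas (fun y : RT => poisson l u (cpi y)).
  apply: (bmeas_poisson l0 l1 (p := fun _ => u)) => //; last exact: cpi_le1.
    exact: bmeas_cst.
  exact: bmeas_cpi.
have bp : bmeas (fun y : RT => ppart l m u (cpi y)).
  apply: (bmeas_ppart l m (p := fun _ => u)); first exact: bmeas_cst.
  exact: bmeas_cpi.
have bT := bmeas_cheb_cpi n.
have <- : mean (fun y : RT => ppart l m u (cpi y) * cheb n (cpi y)) = eigval n * cheb n u.
  rewrite (_ : mean _ = mean (fun y : RT => \sum_(k < m)
      l ^+ k * cheb k u * (cheb k (cpi y) * cheb n (cpi y)))); last first.
    by apply: eq_mean => y _; rewrite mulr_suml; apply: eq_bigr => k _; rewrite mulrA.
  rewrite mean_sum; last first.
    move=> k; apply: bmeasM; first exact: bmeas_cst.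
    by apply: bmeasM => //; exact: bmeas_cheb_cpi.
  have nm : (n < m)%N by rewrite leq_maxr.
  have termE k : mean (fun y : RT => l ^+ k * cheb k u * (cheb k (cpi y) * cheb n (cpi y))) =
      l ^+ k * cheb k u * (if k == n then cheb_norm k else 0).
    by rewrite meanZl ?mean_chebM_cpi//; apply: bmeasM => //; exact: bmeas_cheb_cpi.
  rewrite (bigD1 (Ordinal nm))//= termE eqxx big1; last first.
    by move=> k kn; rewrite termE ifN ?mulr0.
  by rewrite addr0 /eigval; ring.
rewrite -meanB; [|exact: bmeasM..].
apply: norm_mean_le; first by apply: bmeasB; exact: bmeasM.
move=> y _; rewrite -mulrBl normrM.
apply: le_trans (HN m (leq_maxl _ _)).
apply: (le_trans _ (poisson_ppart l0 l1 m u1 (cpi_le1 y))).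
by rewrite ler_piMr// cheb_le1// cpi_le1.
Qed.

End poisson_means.

(** * The forcing functionals *)

Section small_cubes.
Context {R : realType}.
Local Notation RT := (measurableTypeR R).

Definition vtx n k (H : (k < n)%N) : 'I_n := Ordinal H.

Lemma bmeas_slice (A : R -> R -> R) (x : R) :
  bmeas (fun p : RT * RT => A p.1 p.2) -> bmeas (fun y : RT => A x y).
Proof. by move=> bA; exact: (bmeas_section1 x bA). Qed.

Lemma bmeas_slice2 (A : R -> R -> R) (x : R) :
  bmeas (fun p : RT * RT => A p.1 p.2) -> bmeas (fun y : RT => A y x).
Proof. by move=> bA; exact: (bmeas_section2 x bA). Qed.

Lemma bmeas_pair (A : R -> R -> R) d (T : measurableType d) (f g : T -> RT) :
  bmeas (fun p : RT * RT => A p.1 p.2) ->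
  measurable_fun setT f -> measurable_fun setT g -> bmeas (fun x => A (f x) (g x)).
Proof.
move=> bA mf mg; apply: (bmeas_comp (h := fun x => (f x, g x)) bA).
exact/measurable_fun_pairP.
Qed.

(** Distinct copies y, z of one variable express a square without a double edge. *)
Lemma mean_cherry (A : R -> R -> R) : bmeas (fun p : RT * RT => A p.1 p.2) ->
  mean (fun x => mean (fun y => mean (fun z => A x y * A x z))) =
  mean (fun x => mean (fun y => A x y) ^+ 2).
Proof.
move=> bA; apply: eq_mean => x _; have bx := bmeas_slice x bA.
under eq_mean => y _ do rewrite meanZl//.
by rewrite meanZr.
Qed.

(** The C_4-density is the squared Hilbert-Schmidt norm of the square of A. *)
Lemma mean_C4 (A : R -> R -> R) : global_kernel A ->
  mean (fun x => mean (fun y => mean (fun z => mean (fun w =>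
    A x y * A y z * A z w * A x w)))) =
  mean (fun x => mean (fun z => mean (fun y => A x y * A y z) ^+ 2)).
Proof.
move=> [bA sA]; apply: eq_mean => x _.
have bxz z : bmeas (fun y : RT => A x y * A y z).
  by apply: bmeasM; [exact: bmeas_slice|exact: bmeas_slice2].
have bF : bmeas (fun p : RT * RT => mean (fun w => A p.2 w * A x w)).
  apply: (bmeas_mean (f := fun q : RT * RT * RT => A q.1.2 q.2 * A x q.2)).
  apply: bmeasM; apply: bmeas_pair => //; try exact: measurable_snd.
  exact: (measurableT_comp measurable_snd measurable_fst).
transitivity (mean (fun y => mean (fun z => A x y * A y z * mean (fun w => A z w * A x w)))).
  apply: eq_mean => y _; apply: eq_mean => z _; rewrite -meanZl; last first.
    by apply: bmeasM; exact: bmeas_slice.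
  by apply: eq_mean => w _; rewrite mulrA.
rewrite (mean_swap (f := fun p : RT * RT => A x p.1 * A p.1 p.2 *
  mean (fun w => A p.2 w * A x w))); last first.
  apply: bmeasM => //; apply: bmeasM; apply: bmeas_pair => //; try exact: measurable_fst.
apply: eq_mean => z _ /=; rewrite meanZr// expr2; congr (_ * _).
by apply: eq_mean => w _; rewrite mulrC (sA z).
Qed.
End small_cubes.

Section graph_poly_ring.
Context {R : realType}.
Local Notation RT := (measurableTypeR R).
Variable n : nat.
Implicit Types (E : seq ('I_n * 'I_n)) (g h : (R -> R -> R) -> n.-tuple RT -> R).

Lemma graph_poly0 E g : graph_poly [::] g -> graph_poly E g.
Proof. exact: graph_poly_sub. Qed.

Lemma graph_polyN E g : uniq E -> graph_poly E g -> graph_poly E (fun U t => - g U t).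
Proof.
move=> uE /(graph_polyZ (-1) uE) [s [sE gE]]; exists s; split => // U t.
by rewrite -gE mulN1r.
Qed.

Lemma graph_polyX g k : graph_poly [::] g -> graph_poly [::] (fun U t => g U t ^+ k).
Proof.
move=> gg; elim: k => [|k [s [sE gE]]].
  by have [s [sE gE]] := @graph_poly_cst R n 1; exists s; split.
have [s' [sE' gE']] := graph_polyMl (isT : uniq [::]) gg (ex_intro _ s (conj sE gE)).
by exists s'; split => // U t; rewrite -gE' exprS.
Qed.
End graph_poly_ring.

Section forcing.
Context {R : realType}.
Local Notation RT := (measurableTypeR R).
Variable l : R.
Implicit Types U : R -> R -> R.

(** For W_lambda the degree of x is 1/2 + cos (pi x) / 8. There [pcoord] is
    cos (pi x), [poisson_part] is the Poisson kernel, [eigen_defect] has mean zero in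
    y, and [rational_defect] vanishes. *)
Definition pcoord U x : R := 8 * deg U x - 4.

Definition poisson_part U x y : R :=
  U x y - (2^-1 + (pcoord U x + pcoord U y) / 8 + pcoord U x * pcoord U y / 16)
  + (1 + l * pcoord U x * pcoord U y).

Definition eigen_defect n U x y : R :=
  poisson_part U x y * cheb n (pcoord U y) - eigval l n * cheb n (pcoord U x).

Definition rational_defect U x y : R :=
  pden l (pcoord U x) (pcoord U y) * poisson_part U x y - pnum l (pcoord U x) (pcoord U y).

Lemma bmeas_pcoord U : global_kernel U -> bmeas (pcoord U : RT -> R).
Proof.
move=> nU; apply: bmeasB; last exact: bmeas_cst.
by apply: bmeasM; [exact: bmeas_cst|exact: bmeas_deg].
Qed.

Lemma bmeas_pcoord1 U : global_kernel U -> bmeas (fun p : RT * RT => pcoord U p.1).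
Proof. by move=> nU; apply: (bmeas_comp (bmeas_pcoord nU)); exact: measurable_fst. Qed.

Lemma bmeas_pcoord2 U : global_kernel U -> bmeas (fun p : RT * RT => pcoord U p.2).
Proof. by move=> nU; apply: (bmeas_comp (bmeas_pcoord nU)); exact: measurable_snd. Qed.

Lemma bmeas_poisson_part U : global_kernel U -> bmeas (fun p : RT * RT => poisson_part U p.1 p.2).
Proof.
move=> nU; have b1 := bmeas_pcoord1 nU; have b2 := bmeas_pcoord2 nU.
have bc c : bmeas (fun _ : RT * RT => c : R) := bmeas_cst _ c.
by do ![exact: b1|exact: b2|exact: bc|exact: nU.1|apply: bmeasD|apply: bmeasN|apply: bmeasM].
Qed.

Lemma global_kernel_poisson_part U : global_kernel U -> global_kernel (poisson_part U).
Proof.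
move=> nU; split; first exact: bmeas_poisson_part.
by move=> x y; rewrite /poisson_part nU.2; ring.
Qed.

Lemma bmeas_pden d (T : measurableType d) (p q : T -> R) : bmeas p -> bmeas q ->
  bmeas (fun x => pden l (p x) (q x)).
Proof.
move=> bp bq; have bc c : bmeas (fun _ : T => c : R) := bmeas_cst _ c.
by do ![exact: bp|exact: bq|exact: bc|apply: bmeasD|apply: bmeasN|apply: bmeasX|apply: bmeasM].
Qed.

Lemma bmeas_pnum d (T : measurableType d) (p q : T -> R) : bmeas p -> bmeas q ->
  bmeas (fun x => pnum l (p x) (q x)).
Proof.
move=> bp bq; have bc c : bmeas (fun _ : T => c : R) := bmeas_cst _ c.
have bd := bmeas_pden bp bq.
apply: bmeasD; first exact: bmeasM.
by do ![exact: bp|exact: bq|exact: bc|apply: bmeasD|apply: bmeasN|apply: bmeasX|apply: bmeasM].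
Qed.

Lemma global_kernel_rational_defect U : global_kernel U -> global_kernel (rational_defect U).
Proof.
move=> nU; have b1 := bmeas_pcoord1 nU; have b2 := bmeas_pcoord2 nU; split.
  apply: bmeasB; last exact: bmeas_pnum.
  by apply: bmeasM; [exact: bmeas_pden|exact: bmeas_poisson_part].
by move=> x y; rewrite /rational_defect (global_kernel_poisson_part nU).2 /pnum /pden; ring.
Qed.

Lemma bmeas_eigen_defect n U : global_kernel U -> bmeas (fun p : RT * RT => eigen_defect n U p.1 p.2).
Proof.
move=> nU; have b1 := bmeas_pcoord1 nU; have b2 := bmeas_pcoord2 nU.
apply: bmeasB; first by apply: bmeasM; [exact: bmeas_poisson_part|exact: bmeas_cheb].
by apply: bmeasM; [exact: bmeas_cst|exact: bmeas_cheb].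
Qed.

Section polynomials.
Variable n : nat.
Implicit Types i j : 'I_n.

Lemma graph_poly_pcoord i : graph_poly [::] (fun U (t : n.-tuple RT) => pcoord U (tnth t i)).
Proof.
apply: graph_polyD; last exact: graph_poly_cst.
by apply: graph_polyZ => //; exact: graph_poly_deg.
Qed.

Lemma graph_poly_cheb k i :
  graph_poly [::] (fun U (t : n.-tuple RT) => cheb k (pcoord U (tnth t i))).
Proof.
have gp := graph_poly_pcoord i.
elim/nat_ind2: k => [|//|k IH IH1]; first exact: graph_poly_cst.
apply: graph_polyD; last exact: graph_polyN.
apply: (@graph_polyMl R n [::]) => //; apply: (@graph_polyMl R n [::]) => //; exact: graph_poly_cst.
Qed.

Lemma graph_poly_poisson_part i j :
  graph_poly [:: (i, j)] (fun U (t : n.-tuple RT) => poisson_part U (tnth t i) (tnth t j)).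
Proof.
have gi := graph_poly_pcoord i; have gj := graph_poly_pcoord j.
have gc c := @graph_poly_cst R n c.
apply: graph_polyD; last first.
  apply: graph_poly0; apply: graph_polyD => //.
  by apply: (@graph_polyMl R n [::]) => //; exact: (@graph_polyMl R n [::]).
apply: graph_polyD; first exact: graph_poly_edge.
apply: graph_poly0; apply: graph_polyN => //.
by do ![exact: gi|exact: gj|exact: gc|apply: graph_polyD|apply: (@graph_polyMl R n [::])].
Qed.

Lemma graph_poly_eigen_defect k i j :
  graph_poly [:: (i, j)] (fun U (t : n.-tuple RT) => eigen_defect k U (tnth t i) (tnth t j)).
Proof.
apply: graph_polyD; last first.
  apply: graph_poly0; apply: graph_polyN => //; apply: graph_polyZ => //.
  exact: graph_poly_cheb.
have gm := @graph_polyM R n [:: (i, j)] [::].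
by apply: gm => //; [exact: graph_poly_poisson_part|exact: graph_poly_cheb].
Qed.

Lemma graph_poly_pden i j :
  graph_poly [::] (fun U (t : n.-tuple RT) => pden l (pcoord U (tnth t i)) (pcoord U (tnth t j))).
Proof.
have gi := graph_poly_pcoord i; have gj := graph_poly_pcoord j.
have gc c := @graph_poly_cst R n c.
by do ![exact: gi|exact: gj|exact: gc|apply: graph_polyD|apply: graph_polyN|
  apply: graph_polyX|apply: (@graph_polyMl R n [::])].
Qed.

Lemma graph_poly_pnum i j :
  graph_poly [::] (fun U (t : n.-tuple RT) => pnum l (pcoord U (tnth t i)) (pcoord U (tnth t j))).
Proof.
have gi := graph_poly_pcoord i; have gj := graph_poly_pcoord j.
have gc c := @graph_poly_cst R n c.
apply: graph_polyD.
  by apply: (@graph_polyMl R n [::]) => //; exact: graph_poly_pden.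
by do ![exact: gi|exact: gj|exact: gc|apply: graph_polyD|apply: graph_polyN|
  apply: graph_polyX|apply: (@graph_polyMl R n [::])].
Qed.

Lemma graph_poly_rational_defect i j :
  graph_poly [:: (i, j)] (fun U (t : n.-tuple RT) => rational_defect U (tnth t i) (tnth t j)).
Proof.
apply: graph_polyD; last first.
  by apply: graph_poly0; apply: graph_polyN => //; exact: graph_poly_pnum.
by apply: graph_polyMl => //; [exact: graph_poly_pden|exact: graph_poly_poisson_part].
Qed.
End polynomials.

Definition eigen_functional n U : R :=
  mean (fun x => mean (fun y => mean (fun z => eigen_defect n U x y * eigen_defect n U x z))).

Definition rational_functional U : R :=
  mean (fun x => mean (fun y => mean (fun z => mean (fun w =>
    rational_defect U x y * rational_defect U y z * rational_defect U z w * rational_defect U x w)))).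

(** The mean over the cube of three coordinates unfolds to the three iterated means
    of [eigen_functional]. *)
Lemma graph_determined_eigen_functional n : graph_determined (eigen_functional n).
Proof.
have := @graph_polyM R 3 [:: (@vtx 3 0 isT, @vtx 3 1 isT)] [:: (@vtx 3 0 isT, @vtx 3 2 isT)]
  _ _ isT (graph_poly_eigen_defect n _ _) (graph_poly_eigen_defect n _ _).
move/graph_determined_poly; apply => e.
by rewrite !inE => /orP[]/eqP->.
Qed.

Lemma graph_determined_rational_functional : graph_determined rational_functional.
Proof.
pose v0 := @vtx 4 0 isT; pose v1 := @vtx 4 1 isT.
pose v2 := @vtx 4 2 isT; pose v3 := @vtx 4 3 isT.
have g2 := @graph_polyM R 4 [:: (v0, v1)] [:: (v1, v2)] _ _ isT
  (graph_poly_rational_defect _ _) (graph_poly_rational_defect _ _).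
have g3 := @graph_polyM R 4 [:: (v0, v1); (v1, v2)] [:: (v2, v3)] _ _ isT
  g2 (graph_poly_rational_defect _ _).
have := @graph_polyM R 4 [:: (v0, v1); (v1, v2); (v2, v3)] [:: (v0, v3)] _ _ isT
  g3 (graph_poly_rational_defect _ _).
move/graph_determined_poly; apply => e.
by rewrite !inE => /or4P[]/eqP->.
Qed.
End forcing.

(** * The kernel W_lambda *)

Section W_side.
Context {R : realType}.
Local Notation RT := (measurableTypeR R).
Variable l : R.
Hypotheses (l0 : 0 < l) (l1 : l <= 1 / 128).
Local Notation W := (W_lambda l).

Lemma bmeas_wfun d (T : measurableType d) (p q : T -> R) : bmeas p -> bmeas q ->
  (forall x, `|p x| <= 1) -> (forall x, `|q x| <= 1) ->
  bmeas (fun x => wfun l (p x) (q x)).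
Proof.
move=> bp bq p1 q1; have bP := bmeas_poisson l0 l1 bp bq p1 q1.
have bc c : bmeas (fun _ : T => c : R) := bmeas_cst _ c.
by do ![exact: bP|exact: bp|exact: bq|exact: bc|apply: bmeasD|apply: bmeasN|apply: bmeasM].
Qed.

Lemma wfun_sym u v : wfun l u v = wfun l v u.
Proof.
rewrite /wfun /poisson (_ : pnum l u v = pnum l v u).
  by rewrite (_ : pden l u v = pden l v u); [ring|rewrite /pden; ring].
by rewrite /pnum /pden; ring.
Qed.

Lemma global_kernel_wfun (q : RT -> R) : bmeas q -> (forall x, `|q x| <= 1) ->
  global_kernel (fun x y => wfun l (q x) (q y)).
Proof.
move=> bq q1; split; last by move=> x y; rewrite wfun_sym.
by apply: bmeas_wfun => //; apply: (bmeas_comp bq);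
  [exact: measurable_fst|exact: measurable_snd].
Qed.

Lemma W_wfun : W = fun x y => wfun l (cpi x) (cpi y).
Proof. by apply/funext => x; apply/funext => y; rewrite W_lambdaE. Qed.

Lemma global_kernel_W : global_kernel W.
Proof. by rewrite W_wfun; apply: global_kernel_wfun; [exact: bmeas_cpi|exact: cpi_le1]. Qed.

Lemma mean_wfun_cheb (u : R) n : `|u| <= 1 ->
  mean (fun y : RT => wfun l u (cpi y) * cheb n (cpi y)) =
  (u / 8 - 2^-1) * (n == 0%N)%:R +
  (8^-1 + u / 16 - l * u) * (if 1%N == n then 2^-1 else 0) +
  eigval l n * cheb n u.
Proof.
move=> u1; have bT k := @bmeas_cheb_cpi R k.
have bP : bmeas (fun y : RT => poisson l u (cpi y) * cheb n (cpi y)).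
  apply: bmeasM => //; apply: (bmeas_poisson l0 l1 (p := fun _ => u)) => //; last exact: cpi_le1.
    exact: bmeas_cst.
  exact: bmeas_cpi.
have bTT : bmeas (fun y : RT => cheb 1 (cpi y) * cheb n (cpi y)) by exact: bmeasM.
have bc c (f : RT -> R) : bmeas f -> bmeas (fun y => c * f y).
  by move=> bf; apply: bmeasM => //; exact: bmeas_cst.
rewrite -(mean_poisson_cheb l0 l1 n u1) -(mean_chebM_cpi 1 n) -mean_cheb_cpi.
rewrite -!meanZl// -!meanD//; first by apply: eq_mean => y _; rewrite /wfun /=; field.
- by apply: bmeasD; exact: bc.
- exact: bc.
- exact: bc.
Qed.

Lemma deg_W x : deg W x = 2^-1 + cpi x / 8.
Proof.
rewrite /deg W_wfun; have := mean_wfun_cheb 0 (cpi_le1 x).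
rewrite /= /eigval /cheb_norm /= expr0 !mulr1 mulr0 addr0.
under eq_mean do rewrite mulr1.
by move=> ->; field.
Qed.

Lemma pcoord_W x : pcoord W x = cpi x.
Proof. by rewrite /pcoord deg_W; field. Qed.

Lemma poisson_part_W x y : poisson_part l W x y = poisson l (cpi x) (cpi y).
Proof. by rewrite /poisson_part !pcoord_W W_wfun /wfun; field. Qed.

Lemma rational_defect_W x y : rational_defect l W x y = 0.
Proof.
rewrite /rational_defect poisson_part_W !pcoord_W /poisson mulrC mulfVK ?subrr// gt_eqF//.
by apply: (pden_gt0 l0 l1); exact: cpi_le1.
Qed.

Lemma rational_functional_W : rational_functional l W = 0.
Proof.
rewrite /rational_functional -[RHS]mean_cst; apply: eq_mean => x _.
rewrite -[RHS]mean_cst; apply: eq_mean => y _.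
rewrite -[RHS]mean_cst; apply: eq_mean => z _.
by rewrite -[RHS]mean_cst; apply: eq_mean => w _; rewrite rational_defect_W !mul0r.
Qed.

Lemma eigen_functional_W n : eigen_functional l n W = 0.
Proof.
rewrite /eigen_functional mean_cherry; last exact: bmeas_eigen_defect global_kernel_W.
rewrite -[RHS]mean_cst; apply: eq_mean => x _.
rewrite (_ : mean _ = 0) ?expr0n// /eigen_defect meanB; last exact: bmeas_cst.
  rewrite mean_cst pcoord_W -(mean_poisson_cheb l0 l1 n (cpi_le1 x)).
  by apply/eqP; rewrite subr_eq0; apply/eqP; apply: eq_mean => y _; rewrite poisson_part_W pcoord_W.
apply: bmeasM; first exact: bmeas_slice (bmeas_poisson_part l global_kernel_W).
exact: bmeas_cheb (bmeas_pcoord global_kernel_W).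
Qed.

(** Testing against T_2 at both ends isolates the second eigenvalue, and unlike
    [poisson_part] this does not involve l. *)
Definition second_functional (U : R -> R -> R) : R :=
  mean (fun x => mean (fun y => U x y * cheb 2 (pcoord U x) * cheb 2 (pcoord U y))).

Lemma graph_determined_second_functional : graph_determined second_functional.
Proof.
have g1 := @graph_polyM R 2 [:: (@vtx 2 0 isT, @vtx 2 1 isT)] [::] _ _ isT
  (graph_poly_edge _ _) (graph_poly_cheb 2 (@vtx 2 0 isT)).
have := @graph_polyM R 2 [:: (@vtx 2 0 isT, @vtx 2 1 isT)] [::] _ _ isT
  g1 (graph_poly_cheb 2 (@vtx 2 1 isT)).
move/graph_determined_poly; apply => e.
by rewrite !inE => /eqP->.
Qed.

Lemma second_functional_W : second_functional W = l ^+ 2 / 4.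
Proof.
rewrite /second_functional.
transitivity (mean (fun x : RT => l ^+ 2 / 2 * (cheb 2 (cpi x) * cheb 2 (cpi x)))).
  apply: eq_mean => x _.
  transitivity (cheb 2 (cpi x) * mean (fun y : RT => wfun l (cpi x) (cpi y) * cheb 2 (cpi y))).
    rewrite -meanZl; last first.
      apply: bmeasM; last exact: bmeas_cheb_cpi.
      by have := bmeas_slice x global_kernel_W.1; rewrite W_wfun.
    by apply: eq_mean => y _; rewrite !pcoord_W W_wfun mulrCA mulrA.
  by rewrite mean_wfun_cheb ?cpi_le1//= /eigval /cheb_norm /=; ring.
rewrite meanZl; last by apply: bmeasM; exact: bmeas_cheb_cpi.
by rewrite mean_chebM_cpi eqxx /cheb_norm /=; field.
Qed.

Lemma W_not_ae_constant : ~ ae_constant W.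
Proof.
move=> [c Hc].
have bW : bmeas (fun p : RT * RT => W p.1 p.2 * cpi p.1).
  apply: bmeasM; first exact: global_kernel_W.1.
  by apply: (bmeas_comp bmeas_cpi); exact: measurable_fst.
have bc : bmeas (fun p : RT * RT => c * cpi p.1).
  apply: bmeasM; first exact: bmeas_cst.
  by apply: (bmeas_comp bmeas_cpi); exact: measurable_fst.
have : mean (fun x => mean (fun y => W x y * cpi x)) =
       mean (fun x => mean (fun y => c * cpi x)).
  rewrite (mean_prod bW) (mean_prod bc) /Rintegral; congr fine.
  apply: ae_eq_integral.
  - by apply: measurableX; exact: measurable_itv.
  - by apply/measurable_EFinP/measurable_funTS; exact: bW.1.
  - by apply/measurable_EFinP/measurable_funTS; exact: bc.1.
  - by apply: filterS Hc => p Hp Dp; rewrite Hp.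
have T0 : mean (fun x : RT => cpi x) = 0 by have := @mean_cheb_cpi R 1.
have T1 : mean (fun x : RT => cpi x * cpi x) = 2^-1 by have := @mean_chebM_cpi R 1 1.
under [RHS]eq_mean do rewrite mean_cst.
rewrite meanZl ?T0 ?mulr0; last exact: bmeas_cpi.
rewrite (_ : mean _ = mean (fun x : RT => 2^-1 * cpi x + 8^-1 * (cpi x * cpi x))); last first.
  apply: eq_mean => x _; rewrite meanZr; last exact: bmeas_slice global_kernel_W.1.
  by rewrite -/(deg W x) deg_W; ring.
have bcc : bmeas (fun x : RT => cpi x * cpi x) by apply: bmeasM; exact: bmeas_cpi.
rewrite meanD; last 2 first.
- by apply: bmeasM; [exact: bmeas_cst|exact: bmeas_cpi].
- by apply: bmeasM; [exact: bmeas_cst|].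
rewrite !meanZl//; last exact: bmeas_cpi.
rewrite T0 T1 mulr0 add0r => /eqP.
by rewrite mulf_eq0 !invr_eq0 !pnatr_eq0.
Qed.

Lemma is_kernel_W : is_kernel W.
Proof.
have [bW sW] := global_kernel_W; split.
- exact: measurable_funTS bW.1.
- by have [_ [M HM]] := bW; exists M => x y _ _; exact: HM (x, y).
- by move=> x y _ _; exact: sW.
Qed.
End W_side.

(** * Weakly vanishing kernels *)

Ltac bmeas_tac := solve [repeat first [assumption | exact: bmeas_cst
  | apply: bmeasD | apply: bmeasN | apply: bmeasX | apply: bmeasM]].

Section double_means.
Context {R : realType}.
Local Notation RT := (measurableTypeR R).
Implicit Types (F G : RT * RT -> R) (f g h : RT -> R).

Definition mean2 F : R := mean (fun x => mean (fun y => F (x, y))).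

Lemma eq_mean2 F G : F =1 G -> mean2 F = mean2 G.
Proof. by move=> FG; apply: eq_mean => x _; apply: eq_mean => y _; exact: FG. Qed.

Lemma mean2D F G : bmeas F -> bmeas G ->
  mean2 (fun p => F p + G p) = mean2 F + mean2 G.
Proof.
move=> bF bG; rewrite /mean2 -meanD; [|exact: bmeas_mean..].
by apply: eq_mean => x _; rewrite meanD//; exact: bmeas_section1.
Qed.

Lemma mean2Z c F : bmeas F -> mean2 (fun p => c * F p) = c * mean2 F.
Proof.
move=> bF; rewrite /mean2 -meanZl; last exact: bmeas_mean.
by apply: eq_mean => x _; rewrite meanZl//; exact: bmeas_section1.
Qed.

Lemma mean2B F G : bmeas F -> bmeas G ->
  mean2 (fun p => F p - G p) = mean2 F - mean2 G.
Proof.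
move=> bF bG; rewrite /mean2 -meanB; [|exact: bmeas_mean..].
by apply: eq_mean => x _; rewrite meanB//; exact: bmeas_section1.
Qed.

Lemma mean2_prod f g : bmeas f -> bmeas g ->
  mean2 (fun p => f p.1 * g p.2) = mean f * mean g.
Proof.
by move=> bf bg; rewrite /mean2 -meanZr//; apply: eq_mean => x _ /=; rewrite meanZl.
Qed.

Lemma mean2_swap F : bmeas F -> mean2 F = mean2 (fun p => F (p.2, p.1)).
Proof. exact: mean_swap. Qed.

Lemma bmeas_fst f : bmeas f -> bmeas (fun p : RT * RT => f p.1).
Proof. by move=> bf; apply: (bmeas_comp bf); exact: measurable_fst. Qed.

Lemma bmeas_snd f : bmeas f -> bmeas (fun p : RT * RT => f p.2).
Proof. by move=> bf; apply: (bmeas_comp bf); exact: measurable_snd. Qed.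

Lemma affine_ge0_slope0 (a b : R) : (forall t, 0 <= 2 * t * a + b) -> a = 0.
Proof.
move=> H; apply/eqP/negP => /negP a0.
have := H (- (b + 1) / (2 * a)).
have -> : 2 * (- (b + 1) / (2 * a)) * a + b = -1 by field.
by rewrite lerNr oppr0 ler10.
Qed.

(** A function of mean square zero is orthogonal to everything: otherwise the
    mean square of t f + g would become negative for some t. *)
Lemma mean_sq0 f g : bmeas f -> bmeas g -> mean (fun x => f x ^+ 2) = 0 ->
  mean (fun x => f x * g x) = 0.
Proof.
move=> bf bg f0; apply: (@affine_ge0_slope0 _ (mean (fun x => g x ^+ 2))) => t.
have bff : bmeas (fun x => f x ^+ 2) by exact: bmeasX.
have bgg : bmeas (fun x => g x ^+ 2) by exact: bmeasX.
have bfg : bmeas (fun x => f x * g x) by exact: bmeasM.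
have -> : 2 * t * mean (fun x => f x * g x) + mean (fun x => g x ^+ 2) =
    mean (fun x => (t * f x + g x) ^+ 2).
  rewrite -[LHS]add0r -[X in X + _](mulr0 (t ^+ 2)) -f0 -!meanZl// -!meanD; try bmeas_tac.
  by apply: eq_mean => x _; ring.
by apply: mean_ge0 => x _; exact: sqr_ge0.
Qed.

Lemma mean2_sq0 F G : bmeas F -> bmeas G -> mean2 (fun p => F p ^+ 2) = 0 ->
  mean2 (fun p => F p * G p) = 0.
Proof.
move=> bF bG F0; apply: (@affine_ge0_slope0 _ (mean2 (fun p => G p ^+ 2))) => t.
have bFF : bmeas (fun x => F x ^+ 2) by exact: bmeasX.
have bGG : bmeas (fun x => G x ^+ 2) by exact: bmeasX.
have bFG : bmeas (fun x => F x * G x) by exact: bmeasM.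
have -> : 2 * t * mean2 (fun x => F x * G x) + mean2 (fun x => G x ^+ 2) =
    mean2 (fun x => (t * F x + G x) ^+ 2).
  rewrite -[LHS]add0r -[X in X + _](mulr0 (t ^+ 2)) -F0 -!mean2Z// -!mean2D; try bmeas_tac.
  by apply: eq_mean2 => x; ring.
by apply: mean_ge0 => x _; apply: mean_ge0 => y _; exact: sqr_ge0.
Qed.

(** If the C_4-density of A vanishes then the integral operator A has square
    zero, and a symmetric operator of square zero is zero. *)
Lemma C4_weakly_zero (A : R -> R -> R) : global_kernel A ->
  mean (fun x => mean (fun y => mean (fun z => mean (fun w =>
    A x y * A y z * A z w * A x w)))) = 0 ->
  weakly_zero A.
Proof.
move=> nA; rewrite mean_C4// => A0 f g bf bg; have [bA sA] := nA.
pose K (p : RT * RT) := mean (fun y => A p.1 y * A y p.2).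
have bK : bmeas K.
  apply: (bmeas_mean (f := fun q : RT * RT * RT => A q.1.1 q.2 * A q.2 q.1.2)).
  apply: bmeasM; apply: bmeas_pair => //; try exact: measurable_snd.
    exact: (measurableT_comp measurable_fst measurable_fst).
  exact: (measurableT_comp measurable_snd measurable_fst).
pose Af y := mean (fun z => A y z * f z).
have bAf : bmeas (Af : RT -> R).
  apply: (bmeas_mean (f := fun q : RT * RT => A q.1 q.2 * f q.2)).
  by apply: bmeasM => //; exact: bmeas_snd.
have Af0 : mean (fun y => Af y ^+ 2) = 0.
  rewrite -(mean2_sq0 bK (bmeasM (bmeas_fst bf) (bmeas_snd bf)) A0) /mean2.
  transitivity (mean (fun x => mean (fun y => A x y * f x * Af y))); last first.
    apply: eq_mean => x _.
    transitivity (mean (fun y => mean (fun z => A x y * f x * (A y z * f z)))).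
      apply: eq_mean => y _; rewrite meanZl//.
      by apply: bmeasM => //; exact: bmeas_slice.
    rewrite (mean_swap (f := fun p : RT * RT => A x p.1 * f x * (A p.1 p.2 * f p.2))).
      apply: eq_mean => z _ /=; rewrite /K /= -meanZr; last first.
        by apply: bmeasM; [exact: bmeas_slice|exact: bmeas_slice2].
      by apply: eq_mean => y _; ring.
    apply: bmeasM; last by apply: bmeasM => //; exact: bmeas_snd.
    apply: bmeasM; last exact: bmeas_cst.
    by apply: bmeas_pair => //; exact: measurable_fst.
  rewrite (mean_swap (f := fun p : RT * RT => A p.1 p.2 * f p.1 * Af p.2)).
    apply: eq_mean => y _ /=; rewrite expr2 meanZr; last first.
      by apply: bmeasM => //; exact: bmeas_slice2.
    by congr (_ * _); apply: eq_mean => z _; rewrite sA.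
  by apply: bmeasM; [apply: bmeasM => //; exact: bmeas_fst|exact: bmeas_snd].
rewrite (mean_swap (f := fun p : RT * RT => A p.1 p.2 * (f p.1 * g p.2))); last first.
  by apply: bmeasM => //; apply: bmeasM; [exact: bmeas_fst|exact: bmeas_snd].
rewrite -(mean_sq0 bAf bg Af0); apply: eq_mean => y _ /=.
rewrite -meanZr; last by apply: bmeasM => //; exact: bmeas_slice.
by apply: eq_mean => x _; rewrite sA mulrA.
Qed.
End double_means.

(** * Spectrum and degree distribution of a forced kernel *)

Section spectrum.
Context {R : realType}.
Local Notation RT := (measurableTypeR R).
Variable l : R.
Hypotheses (l0 : 0 < l) (l1 : l <= 1 / 128).
Variable U : R -> R -> R.
Hypothesis nU : global_kernel U.
Implicit Types f g h : RT -> R.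

Let bp : bmeas (pcoord U : RT -> R) := bmeas_pcoord nU.
Let bE : bmeas (fun q : RT * RT => poisson_part l U q.1 q.2) := bmeas_poisson_part l nU.

Definition chebU n (x : RT) : R := cheb n (pcoord U x).

Let bT n : bmeas (chebU n).
Proof. exact: bmeas_cheb bp. Qed.

Definition ebil h g : R := mean2 (fun q => poisson_part l U q.1 q.2 * (h q.1 * g q.2)).

Let bEhg h g : bmeas h -> bmeas g ->
  bmeas (fun q : RT * RT => poisson_part l U q.1 q.2 * (h q.1 * g q.2)).
Proof.
by move=> bh bg; apply: bmeasM => //; apply: bmeasM; [exact: bmeas_fst|exact: bmeas_snd].
Qed.

Lemma ebilC h g : bmeas h -> bmeas g -> ebil h g = ebil g h.
Proof.
move=> bh bg; rewrite /ebil mean2_swap; last exact: bEhg.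
by apply: eq_mean2 => q /=; rewrite (global_kernel_poisson_part l nU).2 (mulrC (h _)).
Qed.

Lemma ebilD h g g' : bmeas h -> bmeas g -> bmeas g' ->
  ebil h (fun x => g x + g' x) = ebil h g + ebil h g'.
Proof.
move=> bh bg bg'; rewrite /ebil -mean2D; [|exact: bEhg..].
by apply: eq_mean2 => q /=; rewrite mulrDr mulrDr.
Qed.

Lemma ebilZ h c g : bmeas h -> bmeas g -> ebil h (fun x => c * g x) = c * ebil h g.
Proof.
move=> bh bg; rewrite /ebil -mean2Z; last exact: bEhg.
by apply: eq_mean2 => q /=; ring.
Qed.

(** The equation poisson_part T_n = eigval_n T_n, tested against all h. *)
Definition eigenvector n := forall h, bmeas h ->
  ebil h (chebU n) = eigval l n * mean (fun x => h x * chebU n x).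

(** [eigen_functional] is the mean square of the defect in the eigenvector equation. *)
Lemma eigen_functional_eigenvector n : eigen_functional l n U = 0 -> eigenvector n.
Proof.
rewrite /eigen_functional mean_cherry => [e0|]; last exact: bmeas_eigen_defect.
move=> h bh; have bphi := bmeas_mean (bmeas_eigen_defect l n nU).
have := mean_sq0 bphi bh e0.
have bET : bmeas (fun q : RT * RT => poisson_part l U q.1 q.2 * chebU n q.2).
  by apply: bmeasM => //; exact: bmeas_snd.
have bETm := bmeas_mean bET; have bTn := bT n.
have -> : mean (fun x => mean (fun y => eigen_defect l n U x y) * h x) =
    mean (fun x => mean (fun y => poisson_part l U x y * chebU n y) * h x) -
    eigval l n * mean (fun x => h x * chebU n x).
  rewrite -meanZl -?meanB; try bmeas_tac.
  apply: eq_mean => x _; rewrite /eigen_defect meanB; last exact: bmeas_cst.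
    by rewrite mean_cst /chebU; ring.
  exact: bmeas_section1 bET.
move=> /eqP; rewrite subr_eq0 => /eqP <-.
apply: eq_mean => x _ /=; rewrite -meanZr; last exact: (bmeas_section1 (f := fun q : RT * RT => _) x bET).
by apply: eq_mean => y _; rewrite mulrCA mulrC.
Qed.

Lemma eigval_lt n m : (n < m)%N -> eigval l m < eigval l n.
Proof.
have [L0 L1] := (l0, l1).
move=> nm; rewrite /eigval /cheb_norm; have m0 : (m == 0%N) = false by case: m nm.
have lm : l ^+ m < l ^+ n.
  by rewrite -(subnKC nm) addSn -addnS exprD gtr_pMr ?exprn_gt0// exprn_ilt1//; lra.
rewrite m0; case: ifP => [n0|_]; last by rewrite ltr_pM2r// invr_gt0.
rewrite mulr1; apply: le_lt_trans lm; have : 0 <= l ^+ m by rewrite exprn_ge0// ltW.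
by lra.
Qed.

(** The operator is symmetric and its eigenvalues are distinct. *)
Lemma eigenvector_orth n m : eigenvector n -> eigenvector m -> n != m ->
  mean (fun x => chebU n x * chebU m x) = 0.
Proof.
move=> en em nm; have := em _ (bT n); rewrite ebilC// en//.
rewrite (_ : mean (fun x => chebU m x * chebU n x) = mean (fun x => chebU n x * chebU m x)).
  move/eqP; rewrite -subr_eq0 -mulrBl mulf_eq0 subr_eq0 => /orP[|/eqP//].
  by move: nm; rewrite neq_ltn => /orP[]/eigval_lt h; rewrite ?(gt_eqF h)// (lt_eqF h).
by apply: eq_mean => x _; rewrite mulrC.
Qed.

Hypothesis ratU : weakly_zero (rational_defect l U).

(** The relation pden * poisson_part = pnum tested against h(x) g(y), with pden and
    pnum expanded into monomials. *)
Lemma ebil_recurrence h g : bmeas h -> bmeas g ->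
  (1 - l ^+ 2) ^+ 2 * ebil h g
  - 4 * l * (1 + l ^+ 2) * ebil (fun x => pcoord U x * h x) (fun x => pcoord U x * g x)
  + 4 * l ^+ 2 * ebil (fun x => pcoord U x ^+ 2 * h x) g
  + 4 * l ^+ 2 * ebil h (fun x => pcoord U x ^+ 2 * g x) =
  ((1 - l ^+ 2) ^+ 2 + 1 - l ^+ 4) / 2 * (mean h * mean g)
  - (3 * l + l ^+ 3) * (mean (fun x => pcoord U x * h x) * mean (fun x => pcoord U x * g x))
  + 2 * l ^+ 2 * (mean (fun x => pcoord U x ^+ 2 * h x) * mean g)
  + 2 * l ^+ 2 * (mean h * mean (fun x => pcoord U x ^+ 2 * g x)).
Proof.
move=> bh bg.
have bp1 : bmeas (fun x => pcoord U x * h x) by exact: bmeasM.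
have bp2 : bmeas (fun x => pcoord U x * g x) by exact: bmeasM.
have bp3 : bmeas (fun x => pcoord U x ^+ 2 * h x) by apply: bmeasM => //; exact: bmeasX.
have bp4 : bmeas (fun x => pcoord U x ^+ 2 * g x) by apply: bmeasM => //; exact: bmeasX.
have E1 := bEhg bh bg; have E2 := bEhg bp1 bp2.
have E3 := bEhg bp3 bg; have E4 := bEhg bh bp4.
have bP f g' : bmeas f -> bmeas g' -> bmeas (fun q : RT * RT => f q.1 * g' q.2).
  by move=> bf bg'; apply: bmeasM; [exact: bmeas_fst|exact: bmeas_snd].
have P1 := bP _ _ bh bg; have P2 := bP _ _ bp1 bp2.
have P3 := bP _ _ bp3 bg; have P4 := bP _ _ bh bp4.
apply/eqP; rewrite -subr_eq0; apply/eqP; rewrite -[RHS](ratU bh bg).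
rewrite -/(mean2 (fun q => rational_defect l U q.1 q.2 * (h q.1 * g q.2))).
rewrite /ebil -!mean2_prod// -!mean2Z//.
do ![rewrite -mean2B|rewrite -mean2D]; try solve [do ![exact: E1|exact: E2|exact: E3|exact: E4
  |exact: P1|exact: P2|exact: P3|exact: P4|exact: bmeas_cst
  |apply: bmeasD|apply: bmeasN|apply: bmeasM]].
by apply: eq_mean2 => q; rewrite /rational_defect /pnum /pden /=; field.
Qed.

Lemma mean_mul_chebU n h : bmeas h ->
  mean (fun x => pcoord U x * h x * chebU n.+1 x) =
  (mean (fun x => h x * chebU n.+2 x) + mean (fun x => h x * chebU n x)) / 2.
Proof.
move=> bh; have b1 := bT n; have b2 := bT n.+2.
rewrite -meanD; [|exact: bmeasM..]; rewrite -meanZr; last by apply: bmeasD; exact: bmeasM.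
by apply: eq_mean => x _; rewrite -mulrDr -mulrA mulrCA /chebU mul_cheb mulrA.
Qed.

Lemma eq_ebil h g g' : g =1 g' -> ebil h g = ebil h g'.
Proof. by move=> /funext ->. Qed.

(** Test pden * poisson_part = pnum against T_k with k = n.+2. The monomials of pden
    turn T_k into combinations of T_(k-2), ..., T_(k+2), and only the last of them
    has no known eigenvector equation yet. The polynomial pnum has degree two in v
    and k >= 3, so the right-hand side vanishes by orthogonality. *)
Lemma eigenvector_step n : (0 < n)%N ->
  (forall k, (k <= n.+3)%N -> eigenvector k) -> eigenvector n.+4.
Proof.
have [L0 L1] := (l0, l1); case: n => [//|n] _ IH h bh.
have T0 k : (0 < k)%N -> (k <= n.+4)%N -> mean (chebU k) = 0.
  move=> k0 kn; have := eigenvector_orth (IH k kn) (IH 0%N isT).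
  rewrite -lt0n k0 => /(_ isT) <-.
  by apply: eq_mean => x _; rewrite mulr1.
have bc c : bmeas (fun _ : RT => c : R) := bmeas_cst _ c.
have E0 := ebil_recurrence bh (bT n.+3).
have pT1 k (x : RT) : pcoord U x * chebU k.+1 x = 2^-1 * chebU k.+2 x + 2^-1 * chebU k x.
  by rewrite /chebU mul_cheb mulrDl !(mulrC 2^-1).
have pT2 k (x : RT) : pcoord U x ^+ 2 * chebU k.+2 x =
    4^-1 * chebU k.+4 x + (2^-1 * chebU k.+2 x + 4^-1 * chebU k x).
  by rewrite expr2 -mulrA pT1 mulrDr !(mulrCA (pcoord U x)) !pT1; field.
have bcT c k : bmeas (fun x : RT => c * chebU k x) by exact: bmeasM.
have m1 : mean (fun x => pcoord U x * chebU n.+3 x) = 0.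
  under eq_mean do rewrite pT1.
  by rewrite meanD// !meanZl// (T0 n.+4)// (T0 n.+2) ?mulr0 ?addr0//; lia.
have m2 : mean (fun x => pcoord U x ^+ 2 * chebU n.+3 x) = 0.
  have := eigenvector_orth (IH 2%N isT) (IH n.+3 ltac:(lia)) isT.
  rewrite (_ : mean _ = 2 * mean (fun x => pcoord U x ^+ 2 * chebU n.+3 x) - mean (chebU n.+3)).
    rewrite T0; [|lia|lia]; rewrite subr0 => /eqP; by rewrite mulf_eq0 pnatr_eq0 /= => /eqP.
  rewrite -meanZl -?meanB//; try (by apply: bmeasM => //; exact: bmeasX).
    by apply: eq_mean => x _; rewrite /chebU /=; ring.
  by apply: bmeasM => //; apply: bmeasM => //; exact: bmeasX.
move: E0; rewrite m1 m2 T0; [|lia|lia]; rewrite !mulr0 !addr0 subr0.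
have bph : bmeas (fun x => pcoord U x * h x) by exact: bmeasM.
have bpph : bmeas (fun x => pcoord U x ^+ 2 * h x) by apply: bmeasM => //; exact: bmeasX.
have I1 := IH n.+1 ltac:(lia); have I2 := IH n.+2 ltac:(lia).
have I3 := IH n.+3 ltac:(lia); have I4 := IH n.+4 ltac:(lia).
rewrite (I3 _ bh) (I3 _ bpph).
rewrite (eq_ebil _ (pT1 n.+2)) ebilD// !ebilZ// (I4 _ bph) (I2 _ bph).
rewrite (eq_ebil _ (pT2 n.+1)) ebilD//; last by apply: bmeasD; exact: bcT.
rewrite ebilD// !ebilZ// (I3 _ bh) (I1 _ bh).
rewrite !mean_mul_chebU//.
rewrite (_ : mean (fun x => pcoord U x ^+ 2 * h x * chebU n.+3 x) =
  (mean (fun x => h x * chebU n.+1.+4 x) + 2 * mean (fun x => h x * chebU n.+3 x) +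
   mean (fun x => h x * chebU n.+1 x)) / 4); last first.
  transitivity (mean (fun x => pcoord U x * (pcoord U x * h x) * chebU n.+3 x)).
    by apply: eq_mean => x _; rewrite expr2 mulrA.
  by rewrite mean_mul_chebU// !mean_mul_chebU//; field.
move: (mean _) (mean _) (mean _) (ebil _ _) => X5 X3 X1 B.
rewrite /eigval /cheb_norm /= => H.
have l20 : l ^+ 2 != 0 by rewrite expf_neq0// gt_eqF.
apply: (mulfI l20); apply/eqP; rewrite -subr_eq0 -[X in _ == X]H; apply/eqP.
by rewrite !exprS; field.
Qed.

Lemma all_eigenvectors : (forall k, (k < 5)%N -> eigenvector k) -> forall k, eigenvector k.
Proof.
move=> E5; suff main k : forall j, (j <= k.+4)%N -> eigenvector j.
  by move=> k; apply: (main k); lia.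
elim: k => [|k IH] j jk; first by apply: E5; lia.
have [/IH//|kj] := leqP j k.+4.
have -> : j = k.+1.+4 by lia.
by apply: eigenvector_step => // i ik; apply: IH; lia.
Qed.

Hypothesis eigU : forall k, eigenvector k.

(** Orthogonality to T_0 makes all Chebyshev moments of the degree function those
    of the arcsine law. *)
Lemma mean_chebU n : mean (chebU n) = (n == 0%N)%:R.
Proof.
case: n => [|n] /=.
  by rewrite -[RHS](mean_cst 1); apply: eq_mean.
rewrite -[RHS](eigenvector_orth (eigU n.+1) (eigU 0%N) isT).
by apply: eq_mean => x _; rewrite mulr1.
Qed.

(** Multiplication by p sends T_n to (T_(n+1) + T_(n-1)) / 2, so the moments against
    all T_n follow from those with k = 0. *)
Lemma moment_cheb k n :
  mean (fun x => pcoord U x ^+ k * chebU n x) =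
  mean (fun x : RT => cpi x ^+ k * cheb n (cpi x)).
Proof.
have bX m : bmeas (fun x : RT => pcoord U x ^+ m) by exact: bmeasX.
have bc m : bmeas (fun x : RT => cpi x ^+ m : R) by apply: bmeasX; exact: bmeas_cpi.
have bTc m := @bmeas_cheb_cpi R m.
elim: k n => [|k IH] n.
  transitivity (mean (chebU n)); first by apply: eq_mean => x _; rewrite mul1r.
  by rewrite mean_chebU -mean_cheb_cpi; apply: eq_mean => x _; rewrite mul1r.
case: n => [|n].
  have -> : mean (fun x => pcoord U x ^+ k.+1 * chebU 0 x) = mean (fun x => pcoord U x ^+ k * chebU 1 x).
    by apply: eq_mean => x _; rewrite /chebU /= mulr1 exprSr.
  by rewrite IH; apply: eq_mean => x _; rewrite /= mulr1 exprSr.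
have e1 : mean (fun x => pcoord U x ^+ k.+1 * chebU n.+1 x) =
    (mean (fun x => pcoord U x ^+ k * chebU n.+2 x) + mean (fun x => pcoord U x ^+ k * chebU n x)) / 2.
  by rewrite -mean_mul_chebU//; apply: eq_mean => x _; rewrite exprS.
rewrite e1 !IH -meanD; [|exact: bmeasM..]; rewrite -meanZr; last by apply: bmeasD; exact: bmeasM.
by apply: eq_mean => x _; rewrite exprSr -mulrA mul_cheb; ring.
Qed.

Lemma moment_pcoord k : mean (fun x => pcoord U x ^+ k) = mean (fun x : RT => cpi x ^+ k).
Proof.
have := moment_cheb k 0; rewrite /chebU /=.
by under eq_mean do rewrite mulr1; under [RHS]eq_mean do rewrite mulr1.
Qed.

(** [pcoord U] truncated to [-1, 1]; the moments force the truncation to change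
    nothing up to a null set. *)
Definition pclamp (x : RT) : R := Num.min 1 (Num.max (-1) (pcoord U x)).

Lemma pclamp_le1 x : `|pclamp x| <= 1.
Proof.
rewrite /pclamp ler_norml le_min ge_min lexx /= andbT le_max lexx /=.
by lra.
Qed.

Lemma bmeas_pclamp : bmeas pclamp.
Proof.
split; last by exists 1; exact: pclamp_le1.
apply: measurable_minr; first exact: measurable_cst.
by apply: measurable_maxr; [exact: measurable_cst|exact: bp.1].
Qed.

(** Outside [-1, 1] the squared distance to that interval is at most u^2 - 1, and
    Bernoulli's inequality applies to u^2 = 1 + (u^2 - 1). *)
Lemma clamp_bernoulli n (u : R) :
  n%:R * (u - Num.min 1 (Num.max (-1) u)) ^+ 2 <= u ^+ n.*2.
Proof.
have bern (t : R) : 0 <= t -> n%:R * t <= (1 + t) ^+ n.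
  move=> t0; elim: n => [|n IH]; first by rewrite mul0r expr0.
  have : 1 <= (1 + t) ^+ n by rewrite exprn_ege1// lerDl.
  rewrite exprS -[n.+1]addn1 natrD mulrDl mul1r; nra.
have sq_ge0 : 0 <= u ^+ n.*2 by rewrite -mul2n exprM exprn_ge0// sqr_ge0.
have le_pow (t : R) : 0 <= t -> t <= u ^+ 2 - 1 -> n%:R * t <= u ^+ n.*2.
  move=> t0 tu; apply: (@le_trans _ _ (n%:R * (u ^+ 2 - 1))); first by rewrite ler_wpM2l.
  have := bern (u ^+ 2 - 1) (le_trans t0 tu).
  by rewrite [1 + _]addrC subrK -exprM mul2n.
have [u1|u1] := leP 1 u.
  rewrite (max_idPr _) ?(min_idPl _)//; last by lra.
  by apply: le_pow; [exact: sqr_ge0|nra].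
have [u2|u2] := leP u (-1).
  rewrite (min_idPr _); last by lra.
  by apply: le_pow; [exact: sqr_ge0|nra].
by rewrite (min_idPr (ltW u1)) subrr expr0n /= mulr0.
Qed.

(** By clamp_bernoulli n times this mean is at most the moment of order 2n, which is
    at most 1. *)
Lemma mean_pclamp_sq0 : mean (fun x => (pcoord U x - pclamp x) ^+ 2) = 0.
Proof.
have bd : bmeas (fun x => (pcoord U x - pclamp x) ^+ 2).
  by apply: bmeasX; apply: bmeasB => //; exact: bmeas_pclamp.
apply/eqP; rewrite eq_le; apply/andP; split; last by apply: mean_ge0 => x _; exact: sqr_ge0.
have H n : n%:R * mean (fun x => (pcoord U x - pclamp x) ^+ 2) <= 1.
  rewrite -meanZl//; apply: (@le_trans _ _ (mean (fun x => pcoord U x ^+ n.*2))).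
    apply: le_mean; [by apply: bmeasM => //; exact: bmeas_cst|exact: bmeasX|].
    by move=> x _; exact: clamp_bernoulli.
  rewrite moment_pcoord -[X in _ <= X](mean_cst 1); apply: le_mean.
  - by apply: bmeasX; exact: bmeas_cpi.
  - exact: bmeas_cst.
  - move=> x _; rewrite (le_trans (ler_norm _))// normrX exprn_ile1//.
    exact: cpi_le1.
rewrite leNgt; apply/negP => m0.
have := H (Num.truncn (mean (fun x => (pcoord U x - pclamp x) ^+ 2))^-1).+1.
rewrite -ler_pdivlMr// div1r leNgt => /negP; apply.
exact: truncnS_gt.
Qed.

Lemma pclamp_weak g : bmeas g ->
  mean (fun x => (pcoord U x - pclamp x) * g x) = 0.
Proof.
move=> bg; apply: mean_sq0 => //; last exact: mean_pclamp_sq0.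
by apply: bmeasB => //; exact: bmeas_pclamp.
Qed.

Lemma moment_pclamp k : mean (fun x => pclamp x ^+ k) = mean (fun x : RT => cpi x ^+ k).
Proof.
suff main g : bmeas g -> mean (fun x => pclamp x ^+ k * g x) = mean (fun x => pcoord U x ^+ k * g x).
  rewrite -moment_pcoord; have := main _ (bmeas_cst _ 1).
  by under eq_mean do rewrite mulr1; under [X in _ = X -> _]eq_mean do rewrite mulr1.
have bpc := bmeas_pclamp.
elim: k g => [|k IH] g bg; first by apply: eq_mean => x _; rewrite !expr0.
have -> : mean (fun x => pclamp x ^+ k.+1 * g x) = mean (fun x => pclamp x ^+ k * (pclamp x * g x)).
  by apply: eq_mean => x _; rewrite exprSr mulrA.
rewrite IH; last exact: bmeasM.
have bX : bmeas (fun x => pcoord U x ^+ k) by exact: bmeasX.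
apply/eqP; rewrite eq_sym -subr_eq0 -meanB; try bmeas_tac.
apply/eqP; rewrite -[RHS](@pclamp_weak (fun x => pcoord U x ^+ k * g x)); last exact: bmeasM.
by apply: eq_mean => x _; rewrite exprS; ring.
Qed.
End spectrum.

(** * Identification of a forced kernel *)

Section kernel_identification.
Context {R : realType}.
Local Notation RT := (measurableTypeR R).
Variable l : R.
Hypotheses (l0 : 0 < l) (l1 : l <= 1 / 128).
Variable U : R -> R -> R.
Hypotheses (nU : global_kernel U) (ratU : weakly_zero (rational_defect l U)).
Variable q : RT -> R.
Hypotheses (bq : bmeas q) (q1 : forall x, `|q x| <= 1).
Hypothesis pq : forall g : RT -> R, bmeas g -> mean (fun x => (pcoord U x - q x) * g x) = 0.
Implicit Types (f g : RT -> R) (F : RT * RT -> R).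

Let bp : bmeas (pcoord U : RT -> R) := bmeas_pcoord nU.
Let p1 := bmeas_fst bp.
Let p2 := bmeas_snd bp.
Let q1' := bmeas_fst bq.
Let q2' := bmeas_snd bq.
Let bE : bmeas (fun z : RT * RT => poisson_part l U z.1 z.2) := bmeas_poisson_part l nU.

Definition poisson_defect (z : RT * RT) : R := poisson_part l U z.1 z.2 - poisson l (q z.1) (q z.2).

Let bD : bmeas poisson_defect.
Proof. by apply: bmeasB => //; apply: bmeas_poisson. Qed.

(** Under a mean, p may be replaced by q. *)
Lemma mean2_diff1 F : bmeas F -> mean2 (fun z => (pcoord U z.1 - q z.1) * F z) = 0.
Proof.
move=> bF; rewrite -[RHS](pq (bmeas_mean bF)); apply: eq_mean => x _ /=.
by rewrite -meanZl//; exact: bmeas_section1.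
Qed.

Lemma mean2_diff2 F : bmeas F -> mean2 (fun z => (pcoord U z.2 - q z.2) * F z) = 0.
Proof.
move=> bF; rewrite mean2_swap; first exact: (mean2_diff1 (bmeas_swap bF)).
by apply: bmeasM => //; exact: bmeasB.
Qed.

Ltac bm := solve [do ![exact: p1|exact: p2|exact: q1'|exact: q2'|exact: bE|exact: bD
  |assumption|exact: bmeas_cst|apply: bmeasD|apply: bmeasN|apply: bmeasX|apply: bmeasM]].

(** For p in place of q this is the hypothesis on rational_defect. The difference is
    a combination of p(x) - q(x) and p(y) - q(y), whose coefficients R1 and R2 are
    the divided differences. *)
Lemma pden_poisson_defect f g : bmeas f -> bmeas g ->
  mean2 (fun z => pden l (q z.1) (q z.2) * poisson_defect z * (f z.1 * g z.2)) = 0.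
Proof.
move=> bf bg; have f1 := bmeas_fst bf; have g2 := bmeas_snd bg.
pose r1 (z : RT * RT) : R := - 4 * l * (1 + l ^+ 2) * pcoord U z.2 + 4 * l ^+ 2 * (pcoord U z.1 + q z.1).
pose r2 (z : RT * RT) : R := - 4 * l * (1 + l ^+ 2) * q z.1 + 4 * l ^+ 2 * (pcoord U z.2 + q z.2).
pose R1 (z : RT * RT) : R := (r1 z * poisson_part l U z.1 z.2 - r1 z / 2 + (1 - l ^+ 2) * l * pcoord U z.2) *
  (f z.1 * g z.2).
pose R2 (z : RT * RT) : R := (r2 z * poisson_part l U z.1 z.2 - r2 z / 2 + (1 - l ^+ 2) * l * q z.1) *
  (f z.1 * g z.2).
have br1 : bmeas r1 by bm.
have br2 : bmeas r2 by bm.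
have bR1 : bmeas R1 by bm.
have bR2 : bmeas R2 by bm.
have bG : bmeas (fun z : RT * RT => rational_defect l U z.1 z.2 * (f z.1 * g z.2)).
  by apply: bmeasM; [exact: (global_kernel_rational_defect l nU).1|bm].
transitivity (mean2 (fun z => rational_defect l U z.1 z.2 * (f z.1 * g z.2) -
    ((pcoord U z.1 - q z.1) * R1 z + (pcoord U z.2 - q z.2) * R2 z))).
  apply: eq_mean2 => z; rewrite /poisson_defect /rational_defect.
  have Q0 : pden l (q z.1) (q z.2) != 0 by rewrite gt_eqF// (pden_gt0 l0 l1).
  have -> : pden l (q z.1) (q z.2) * (poisson_part l U z.1 z.2 - poisson l (q z.1) (q z.2)) =
     pden l (q z.1) (q z.2) * poisson_part l U z.1 z.2 - pnum l (q z.1) (q z.2).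
    by rewrite mulrBr /poisson [X in _ - X = _]mulrC divfK.
  by rewrite /R1 /R2 /r1 /r2 /pnum /pden; field.
rewrite mean2B//; last by bm.
rewrite mean2D; [|bm|bm].
by rewrite (mean2_diff1 bR1) (mean2_diff2 bR2) addr0 subr0 /mean2 /= (ratU bf bg).
Qed.

(** The remainder in pden = (1 + l^2)^2 (1 - pcontr); as it is at most 1/2, pden is
    invertible by a geometric series. *)
Definition pcontr (z : RT * RT) : R :=
  4 * l * (1 + l ^+ 2) / (1 + l ^+ 2) ^+ 2 * (q z.1 * q z.2)
  - 4 * l ^+ 2 / (1 + l ^+ 2) ^+ 2 * q z.1 ^+ 2
  - 4 * l ^+ 2 / (1 + l ^+ 2) ^+ 2 * q z.2 ^+ 2
  + 4 * l ^+ 2 / (1 + l ^+ 2) ^+ 2.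

Let c0 : 1 + l ^+ 2 != 0.
Proof. by rewrite gt_eqF// ltr_pwDl// sqr_ge0. Qed.

Lemma pden_pcontr z : pden l (q z.1) (q z.2) = (1 + l ^+ 2) ^+ 2 * (1 - pcontr z).
Proof. by rewrite /pcontr /pden; field; exact: c0. Qed.

Lemma pcontr_le z : `|pcontr z| <= 2^-1.
Proof.
have [L0 L1] := (l0, l1).
have -> : pcontr z = (4 * l * (1 + l ^+ 2) * (q z.1 * q z.2) -
    4 * l ^+ 2 * (q z.1 ^+ 2 + q z.2 ^+ 2 - 1)) / (1 + l ^+ 2) ^+ 2.
  by rewrite /pcontr; field; exact: c0.
have qq : `|q z.1 * q z.2| <= 1 by rewrite normrM mulr_ile1.
have s1 : 0 <= q z.1 ^+ 2 <= 1 by rewrite sqr_ge0 -real_normK ?num_real// exprn_ile1.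
have s2 : 0 <= q z.2 ^+ 2 <= 1 by rewrite sqr_ge0 -real_normK ?num_real// exprn_ile1.
have l2 : 0 <= l ^+ 2 <= 1 / 128 * l by rewrite sqr_ge0 expr2 ler_wpM2r// ltW.
have d1 : 1 <= (1 + l ^+ 2) ^+ 2 by rewrite exprn_ege1// lerDl sqr_ge0.
have d0 : 0 < (1 + l ^+ 2) ^+ 2 by exact: lt_le_trans d1.
rewrite normrM normfV (gtr0_norm d0) ler_pdivrMr//.
apply: (@le_trans _ _ 2^-1); last by rewrite ler_peMr// invr_ge0.
apply: (le_trans (ler_normB _ _)).
have -> : 2^-1 = 4^-1 + 4^-1 :> R by field.
apply: lerD; rewrite normrM.
  rewrite -[leRHS]mulr1; apply: ler_pM => //; rewrite ger0_norm; last by nra.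
  by nra.
rewrite -[leRHS]mulr1; apply: ler_pM => //; rewrite ler_norml; apply/andP; split; by lra.
Qed.

Lemma bmeas_pcontr : bmeas pcontr.
Proof. by bm. Qed.

(** A power of pcontr is a sum of products of functions of x and of y, and these can
    be absorbed by f and g. *)
Lemma pden_pcontr_pow k f g : bmeas f -> bmeas g ->
  mean2 (fun z => pden l (q z.1) (q z.2) * poisson_defect z * (pcontr z ^+ k * (f z.1 * g z.2))) = 0.
Proof.
have bs := bmeas_pcontr.
have bQ : bmeas (fun z => pden l (q z.1) (q z.2)) by exact: bmeas_pden.
elim: k f g => [|k IH] f g bf bg.
  by rewrite -[RHS](pden_poisson_defect bf bg); apply: eq_mean2 => z; rewrite mul1r.
have bqf : bmeas (fun x => q x * f x) by exact: bmeasM.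
have bqg : bmeas (fun x => q x * g x) by exact: bmeasM.
have bqqf : bmeas (fun x => q x ^+ 2 * f x) by apply: bmeasM => //; exact: bmeasX.
have bqqg : bmeas (fun x => q x ^+ 2 * g x) by apply: bmeasM => //; exact: bmeasX.
pose Q z := pden l (q z.1) (q z.2) * poisson_defect z.
have bQD : bmeas Q by bm.
pose T f g (z : RT * RT) := Q z * (pcontr z ^+ k * (f z.1 * g z.2)).
have bT f' g' : bmeas f' -> bmeas g' -> bmeas (T f' g').
  by move=> /bmeas_fst bf' /bmeas_snd bg'; bm.
have T1 := bT _ _ bqf bqg; have T2 := bT _ _ bqqf bg.
have T3 := bT _ _ bf bqqg; have T4 := bT _ _ bf bg.
set a := 4 * l * (1 + l ^+ 2) / (1 + l ^+ 2) ^+ 2.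
set b := 4 * l ^+ 2 / (1 + l ^+ 2) ^+ 2.
transitivity (mean2 (fun z => a * T (fun x => q x * f x) (fun x => q x * g x) z
  + - b * T (fun x => q x ^+ 2 * f x) g z + - b * T f (fun x => q x ^+ 2 * g x) z
  + b * T f g z)).
  by apply: eq_mean2 => z; rewrite exprS {1}/pcontr -/a -/b /T /Q; ring.
do 3! (rewrite mean2D; [|bm|bm]).
rewrite !mean2Z//.
have e1 := IH _ _ bqf bqg; have e2 := IH _ _ bqqf bg.
have e3 := IH _ _ bf bqqg; have e4 := IH _ _ bf bg.
by rewrite /T /Q e1 e2 e3 e4 !mulr0 !addr0.
Qed.

(** By pden_pcontr_pow the mean does not change when the integrand is multiplied by
    pcontr^k, which makes it at most a constant times 2^-k. *)
Lemma poisson_defect_weakly_zero f g : bmeas f -> bmeas g ->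
  mean2 (fun z => poisson_defect z * (f z.1 * g z.2)) = 0.
Proof.
move=> bf bg; have bs := bmeas_pcontr.
have f1 := bmeas_fst bf; have g2 := bmeas_snd bg.
have bF k : bmeas (fun z => pcontr z ^+ k * (poisson_defect z * (f z.1 * g z.2))) by bm.
have step k : mean2 (fun z => pcontr z ^+ k * (poisson_defect z * (f z.1 * g z.2))) =
    mean2 (fun z => poisson_defect z * (f z.1 * g z.2)).
  elim: k => [|k IH]; first by apply: eq_mean2 => z; rewrite mul1r.
  rewrite -IH; apply/eqP; rewrite eq_sym -subr_eq0 -mean2B//.
  have c2 : (1 + l ^+ 2) ^+ 2 != 0 by rewrite expf_neq0// c0.
  rewrite -(mulrI_eq0 _ (mulfI c2)) -mean2Z; last exact: bmeasB.
  apply/eqP; rewrite -[RHS](pden_pcontr_pow k bf bg); apply: eq_mean2 => z.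
  by rewrite pden_pcontr (exprS (pcontr z)); ring.
have [M HM] : exists M, forall z, `|poisson_defect z * (f z.1 * g z.2)| <= M.
  by have [_] : bmeas (fun z => poisson_defect z * (f z.1 * g z.2)) by bm.
set m := mean2 _.
have Hk k : `|m| * k%:R <= M.
  have le1 : `|m| <= 2^-1 ^+ k * M.
    rewrite /m -(step k); apply: norm_mean_le; first exact: bmeas_mean (bF k).
    move=> x _; apply: norm_mean_le; first exact: bmeas_section1 (bF k).
    move=> y _; rewrite normrM ler_pM// normrX; apply: lerXn2r; rewrite ?nnegrE ?invr_ge0//.
    exact: pcontr_le.
  have k2 : k%:R <= 2 ^+ k :> R by rewrite -natrX ler_nat ltnW// ltn_expl.
  have M0 : 0 <= M by exact: le_trans (HM (0, 0)).
  apply: (le_trans (ler_wpM2r (ler0n _ k) le1)).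
  rewrite mulrAC -[leRHS]mul1r ler_wpM2r//.
  by rewrite exprVn mulrC ler_pdivrMr ?exprn_gt0// mul1r.
apply/eqP; rewrite -normr_eq0; apply/negP => /negP m0.
have mp : 0 < `|m| by rewrite lt_def m0 normr_ge0.
have := Hk (Num.truncn (M / `|m|)).+1.
rewrite mulrC -ler_pdivlMr// leNgt => /negP; apply; exact: truncnS_gt.
Qed.

Lemma kernel_identified : weakly_zero (fun x y => U x y - wfun l (q x) (q y)).
Proof.
move=> f g bf bg; have f1 := bmeas_fst bf; have g2 := bmeas_snd bg.
pose R1 (z : RT * RT) : R := (8^-1 + (16^-1 - l) * pcoord U z.2) * (f z.1 * g z.2).
pose R2 (z : RT * RT) : R := (8^-1 + (16^-1 - l) * q z.1) * (f z.1 * g z.2).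
have bR1 : bmeas R1 by bm.
have bR2 : bmeas R2 by bm.
transitivity (mean2 (fun z => poisson_defect z * (f z.1 * g z.2) +
    ((pcoord U z.1 - q z.1) * R1 z + (pcoord U z.2 - q z.2) * R2 z))).
  apply: (eq_mean2 (F := fun z => (U z.1 z.2 - wfun l (q z.1) (q z.2)) * (f z.1 * g z.2))) => z.
  by rewrite /poisson_defect /poisson_part /wfun /R1 /R2; field.
rewrite mean2D; [|bm|bm]; rewrite mean2D; [|bm|bm].
by rewrite (mean2_diff1 bR1) (mean2_diff2 bR2) (poisson_defect_weakly_zero bf bg) !addr0.
Qed.
End kernel_identification.

(** * Transfer of densities through moments *)

Section uniform_polynomial_approximation.
Context {R : realType}.
Local Notation RT := (measurableTypeR R).
Implicit Types phi psi : R -> R.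

Definition poly_approx phi := forall e : R, 0 < e ->
  exists P : {poly R}, forall u, `|u| <= 1 -> `|phi u - P.[u]| <= e.

Lemma poly_bounded (P : {poly R}) : exists2 B : R, 0 < B & forall u, `|u| <= 1 -> `|P.[u]| <= B.
Proof.
exists (1 + \sum_(i < size P) `|P`_i|); first by rewrite ltr_pwDl// sumr_ge0.
move=> u u1; rewrite horner_coef (le_trans (ler_norm_sum _ _ _))//.
apply: (@le_trans _ _ (\sum_(i < size P) `|P`_i|)); last by rewrite lerDr.
apply: ler_sum => i _; rewrite normrM ler_piMr// normrX exprn_ile1//.
Qed.

Lemma poly_approx_cst c : poly_approx (fun _ => c).
Proof. by move=> e e0; exists c%:P => u _; rewrite hornerC subrr normr0 ltW. Qed.

Lemma poly_approx_id : poly_approx id.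
Proof. by move=> e e0; exists 'X => u _; rewrite hornerX subrr normr0 ltW. Qed.

Lemma poly_approxD phi psi : poly_approx phi -> poly_approx psi ->
  poly_approx (fun u => phi u + psi u).
Proof.
move=> ap aq e e0; have e2 : 0 < e / 2 by rewrite divr_gt0.
have [P HP] := ap _ e2; have [Q HQ] := aq _ e2; exists (P + Q) => u u1.
rewrite hornerD opprD addrACA (le_trans (ler_normD _ _))// [leRHS](splitr e).
by rewrite lerD ?HP ?HQ.
Qed.

Lemma poly_approxM phi psi : poly_approx phi -> poly_approx psi ->
  poly_approx (fun u => phi u * psi u).
Proof.
move=> ap aq e e0.
have [P0 HP0] := ap 1 ltr01; have [B0 B00 HB0] := poly_bounded P0.
have e2 : 0 < e / 2 / (B0 + 1) by rewrite !divr_gt0// addr_gt0.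
have [Q HQ] := aq _ e2; have [B B00' HB] := poly_bounded Q.
have e3 : 0 < e / 2 / B by rewrite !divr_gt0.
have [P HP] := ap _ e3; exists (P * Q) => u u1.
have phiB : `|phi u| <= B0 + 1.
  rewrite -[phi u](subrK P0.[u]) addrC (le_trans (ler_normD _ _))// lerD ?HB0 ?HP0//.
rewrite hornerM.
have -> : phi u * psi u - P.[u] * Q.[u] =
    phi u * (psi u - Q.[u]) + (phi u - P.[u]) * Q.[u] by ring.
rewrite (le_trans (ler_normD _ _))// [leRHS](splitr e) !normrM lerD//.
  apply: (le_trans (ler_pM _ _ phiB (HQ u u1))) => //.
  by rewrite mulrC divfK// gt_eqF// addr_gt0.
apply: (le_trans (ler_pM _ _ (HP u u1) (HB u u1))) => //.
by rewrite divfK// gt_eqF.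
Qed.

Lemma poly_approxN phi : poly_approx phi -> poly_approx (fun u => - phi u).
Proof.
move=> ap e e0; have [P HP] := ap e e0; exists (- P) => u u1.
by rewrite hornerN -opprD normrN HP.
Qed.

Lemma poly_approx_sum I (s : seq I) (F : I -> R -> R) :
  (forall i, poly_approx (F i)) -> poly_approx (fun u => \sum_(i <- s) F i u).
Proof.
move=> aF; elim: s => [|i s IH].
  by under eq_fun do rewrite big_nil; exact: poly_approx_cst.
by under eq_fun do rewrite big_cons; exact: poly_approxD.
Qed.

Lemma poly_approx_lim phi :
  (forall e, 0 < e -> exists2 psi, poly_approx psi &
     forall u, `|u| <= 1 -> `|phi u - psi u| <= e) -> poly_approx phi.
Proof.
move=> H e e0; have e2 : 0 < e / 2 by rewrite divr_gt0.
have [psi /(_ _ e2)[P HP] Hpsi] := H _ e2; exists P => u u1.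
rewrite -[phi u](subrK (psi u)) -addrA (le_trans (ler_normD _ _))// [leRHS](splitr e).
by rewrite lerD ?HP ?Hpsi.
Qed.

Lemma poly_approx_cheb n : poly_approx (cheb n).
Proof.
elim/nat_ind2: n => [||n IH IH1]; first exact: poly_approx_cst.
  exact: poly_approx_id.
apply: poly_approxD; last exact: poly_approxN.
apply: poly_approxM => //; apply: poly_approxM; last exact: poly_approx_id.
exact: poly_approx_cst.
Qed.

Lemma mean_poly_approx phi (q r : RT -> R) : poly_approx phi ->
  bmeas q -> bmeas r -> (forall x, `|q x| <= 1) -> (forall x, `|r x| <= 1) ->
  (forall k, mean (fun x => q x ^+ k) = mean (fun x => r x ^+ k)) ->
  bmeas (fun x => phi (q x)) -> bmeas (fun x => phi (r x)) ->
  mean (fun x => phi (q x)) = mean (fun x => phi (r x)).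
Proof.
move=> ap bq br q1 r1 qr bpq bpr.
have bP (P : {poly R}) (t : RT -> R) : bmeas t -> bmeas (fun x => P.[t x]).
  move=> bt; rewrite (_ : (fun x => P.[t x]) = fun x => \sum_(i < size P) P`_i * t x ^+ i).
    by apply: bmeas_sum => i; bmeas_tac.
  by apply/funext => x; rewrite horner_coef.
have mP (P : {poly R}) (t : RT -> R) : bmeas t ->
    mean (fun x => P.[t x]) = \sum_(i < size P) P`_i * mean (fun x => t x ^+ i).
  move=> bt; rewrite (_ : (fun x => P.[t x]) = fun x => \sum_(i < size P) P`_i * t x ^+ i).
    rewrite mean_sum => [|i]; last by bmeas_tac.
    by apply: eq_bigr => i _; rewrite meanZl//; exact: bmeasX.
  by apply/funext => x; rewrite horner_coef.
apply/eqP; rewrite -subr_eq0 -normr_le0; apply/ler_addgt0Pr => e e0; rewrite add0r.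
have e2 : 0 < e / 2 by rewrite divr_gt0.
have [P HP] := ap _ e2.
have close t : bmeas t -> (forall x, `|t x| <= 1) -> bmeas (fun x => phi (t x)) ->
    `|mean (fun x => phi (t x)) - mean (fun x => P.[t x])| <= e / 2.
  move=> bt t1 bpt; rewrite -meanB//; last exact: bP.
  by apply: norm_mean_le => [|x _]; [apply: bmeasB => //; exact: bP|exact: HP].
have eP : mean (fun x => P.[q x]) = mean (fun x => P.[r x]).
  by rewrite !mP//; apply: eq_bigr => i _; rewrite qr.
have := close q bq q1 bpq; have := close r br r1 bpr; rewrite eP !ler_norml; lra.
Qed.
End uniform_polynomial_approximation.

Section moment_transfer.
Context {R : realType}.
Local Notation RT := (measurableTypeR R).
Variable l : R.
Hypotheses (l0 : 0 < l) (l1 : l <= 1 / 128).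

Lemma poly_approx_wfun v : `|v| <= 1 -> poly_approx (fun u => wfun l u v).
Proof.
move=> v1.
have aP : poly_approx (fun u => poisson l u v).
  apply: poly_approx_lim => e e0; have [n Hn] := small_geom l0 l1 e0.
  exists (fun u => ppart l n u v).
    apply: poly_approx_sum => k; apply: poly_approxM; last exact: poly_approx_cst.
    by apply: poly_approxM; [exact: poly_approx_cst|exact: poly_approx_cheb].
  by move=> u u1; apply: le_trans (Hn n (leqnn _)); exact: poisson_ppart.
have ac c : poly_approx (fun _ => c : R) := poly_approx_cst c.
have ai := @poly_approx_id R.
by do ![exact: aP|exact: ac|exact: ai|apply: poly_approxD|apply: poly_approxN|apply: poly_approxM].
Qed.

Section transfer.
Variables (q r : RT -> R).
Hypotheses (bq : bmeas q) (br : bmeas r).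
Hypotheses (q1 : forall x, `|q x| <= 1) (r1 : forall x, `|r x| <= 1).
Hypothesis qr : forall k, mean (fun x => q x ^+ k) = mean (fun x => r x ^+ k).

(* The first m coordinates already use r, the others still use q. *)
Let mix m n (t : n.-tuple RT) : n.-tuple RT :=
  [tuple if (k < m)%N then r (tnth t k) else q (tnth t k) | k < n].

Let mix_le1 m n (t : n.-tuple RT) k : `|tnth (mix m t) k| <= 1.
Proof. by rewrite tnth_mktuple; case: ifP. Qed.

Let bmeas_mix m n k : bmeas (fun t : n.-tuple RT => tnth (mix m t) k).
Proof.
under eq_fun do rewrite tnth_mktuple.
by case: (k < m)%N; [apply: (bmeas_comp br)|apply: (bmeas_comp bq)]; exact: measurable_tnth.
Qed.

Let bmeas_edge_prod_mix m n (S : seq ('I_n * 'I_n)) :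
  bmeas (fun t : n.-tuple RT => edge_prod (wfun l) S (mix m t)).
Proof.
apply: bmeas_prod => e; apply: (bmeas_wfun l0 l1) => *; first exact: bmeas_mix.
- exact: bmeas_mix.
- exact: mix_le1.
- exact: mix_le1.
Qed.

(** Exchange q for r one coordinate at a time: in each coordinate the integrand is a
    product of functions wfun(., v), hence a uniform limit of polynomials, and its
    mean depends on moments only. *)
Lemma cube_mean_wfun_transfer n (S : seq ('I_n * 'I_n)) :
  (forall e, e \in S -> (e.1 < e.2)%N) ->
  cube_mean (edge_prod (fun x y => wfun l (q x) (q y)) S) =
  cube_mean (edge_prod (fun x y => wfun l (r x) (r y)) S).
Proof.
move=> lS.
have mix0 : cube_mean (edge_prod (fun x y => wfun l (q x) (q y)) S) =
    cube_mean (fun t => edge_prod (wfun l) S (mix 0 t)).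
  by apply: eq_cube_mean => t _; apply: eq_bigr => e _; rewrite !tnth_mktuple.
have mixn : cube_mean (edge_prod (fun x y => wfun l (r x) (r y)) S) =
    cube_mean (fun t => edge_prod (wfun l) S (mix n t)).
  by apply: eq_cube_mean => t _; apply: eq_bigr => e _; rewrite !tnth_mktuple !ltn_ord.
rewrite mix0 mixn.
suff step m : (m < n)%N -> cube_mean (fun t => edge_prod (wfun l) S (mix m t)) =
    cube_mean (fun t => edge_prod (wfun l) S (mix m.+1 t)).
  suff H m : (m <= n)%N -> cube_mean (fun t => edge_prod (wfun l) S (mix 0 t)) =
      cube_mean (fun t => edge_prod (wfun l) S (mix m t)) by exact: H.
  by elim: m => [//|m IH] mn; exact: etrans (IH (ltnW mn)) (step m mn).
move=> mn; pose i := Ordinal mn.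
rewrite (cube_mean_upd i (bmeas_edge_prod_mix m S)) (cube_mean_upd i (bmeas_edge_prod_mix m.+1 S)).
apply: eq_cube_mean => t _.
pose phi u := edge_prod (wfun l) S (upd (mix m t) i u).
have e1 s : edge_prod (wfun l) S (mix m (upd t i s)) = phi (q s).
  congr (edge_prod _ _ _); apply: eq_from_tnth => k.
  by rewrite !(tnth_upd, tnth_mktuple); case: eqP => [->|_]; rewrite ?ltnn.
have e2 s : edge_prod (wfun l) S (mix m.+1 (upd t i s)) = phi (r s).
  congr (edge_prod _ _ _); apply: eq_from_tnth => k.
  rewrite !(tnth_upd, tnth_mktuple); case: eqP => [->|ki]; first by rewrite /= ltnSn.
  by rewrite ltnS leq_eqVlt -[_ == m](_ : (k == i) = _)//; case: eqP ki.
have aphi : poly_approx phi.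
  have : forall e, e \in S -> (e.1 < e.2)%N := lS.
  rewrite /phi /edge_prod; elim: (S) => [|e S' IH] lS'.
    by under eq_fun do rewrite big_nil; exact: poly_approx_cst.
  under eq_fun do rewrite big_cons.
  apply: poly_approxM; last by apply: IH => e' e'S; apply: lS'; rewrite inE e'S orbT.
  have : (e.1 < e.2)%N by apply: lS'; rewrite inE eqxx.
  under eq_fun do rewrite !tnth_upd.
  have [->|n1] := eqVneq e.1 i; have [->|n2] := eqVneq e.2 i; rewrite ?ltnn// => _.
  - by apply: poly_approx_wfun; exact: mix_le1.
  - have /poly_approx_wfun := mix_le1 m t e.1.
    by under eq_fun do rewrite wfun_sym.
  - exact: poly_approx_cst.
under eq_mean => s _ do rewrite e1.
under [RHS]eq_mean => s _ do rewrite e2.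
have b1 := bmeas_updr t i (bmeas_edge_prod_mix m S).
have b2 := bmeas_updr t i (bmeas_edge_prod_mix m.+1 S).
apply: mean_poly_approx => //.
  by move: b1; under eq_fun do rewrite e1.
by move: b2; under eq_fun do rewrite e2.
Qed.
End transfer.
End moment_transfer.

(** * Finite forcibility *)

Section forcibility.
Context {R : realType}.
Local Notation RT := (measurableTypeR R).

(** Values off the unit square do not affect densities, and zero there makes U a
    bounded measurable function on the whole plane. *)
Definition clip (U : R -> R -> R) (x y : R) : R :=
  if (0 <= x <= 1) && (0 <= y <= 1) then U x y else 0.

Lemma global_kernel_clip U : is_kernel U -> global_kernel (clip U).
Proof.
move=> [mU [M HM] sU]; split; last first.
  move=> x y; rewrite /clip andbC; case: ifP => // /andP[y01 x01].
  by apply: sU; rewrite in_itv.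
split; last first.
  exists (Num.max M 0) => -[x y]; rewrite /clip /=; case: ifP => [/andP[x01 y01]|_].
    by rewrite le_max HM// in_itv.
  by rewrite normr0 le_max lexx orbT.
have mS : measurable (@unit_square R) by apply: measurableX; exact: measurable_itv.
rewrite (_ : (fun p => _) = (fun p : RT * RT => U p.1 p.2) \_ (@unit_square R)).
  exact: (measurable_restrictT _ mS).1 mU.
apply/funext => -[x y]; rewrite patchE /clip /=.
have -> : ((x, y) \in @unit_square R) = (0 <= x <= 1) && (0 <= y <= 1).
  apply/idP/andP => [|[x01 y01]].
    by rewrite inE => -[]; rewrite /= !in_itv.
  by rewrite inE; split; rewrite /= in_itv.
by [].
Qed.

Lemma hom_density_clip F U : hom_density F (clip U) = hom_density F U.
Proof.
apply: eq_Rintegral => t; rewrite inE => t01; apply: eq_bigr => ij _.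
rewrite /clip; have := t01 ij.1; have := t01 ij.2.
by rewrite !in_itv /= => -> ->.
Qed.

Lemma graph_determined_all N (Phi : nat -> (R -> R -> R) -> R) :
  (forall k, (k < N)%N -> graph_determined (Phi k)) ->
  exists (m : nat) (F : 'I_m -> sgraph), forall U V, global_kernel U -> global_kernel V ->
    (forall i, hom_density (F i) U = hom_density (F i) V) ->
    forall k, (k < N)%N -> Phi k U = Phi k V.
Proof.
elim: N => [|N IH] gd; first by exists 0%N, (fun _ => edges_graph (n := 0) [::]).
have [|m [F HF]] := IH; first by move=> k kN; apply: gd; rewrite ltnS ltnW.
have [m' [F' HF']] := gd N (ltnSn N).
exists (m + m')%N, (fun i : 'I_(m + m') => match fintype.split i with inl j => F j | inr j => F' j end).
move=> U V nU nV UV k; rewrite ltnS leq_eqVlt => /predU1P[->|kN].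
  by apply: HF' => // i; have := UV (rshift m i); rewrite (unsplitK (inr i)).
by apply: HF => // i; have := UV (lshift m' i); rewrite (unsplitK (inl i)).
Qed.

Variable l : R.
Hypotheses (l0 : 0 < l) (l1 : l <= 1 / 128).
Local Notation W := (W_lambda l).

Lemma W_finitely_forcible : finitely_forcible W.
Proof.
have [|m [F HF]] := @graph_determined_all 6
    (fun k => if (k < 5)%N then eigen_functional l k else rational_functional l).
  move=> k _; case: ifP => _; first exact: graph_determined_eigen_functional.
  exact: graph_determined_rational_functional.
exists m, F => U kU UF.
have nU := global_kernel_clip kU; have nW := global_kernel_W l0 l1.
have {HF UF}H : forall k, (k < 6)%N ->
    (if (k < 5)%N then eigen_functional l k else rational_functional l) (clip U) =
    (if (k < 5)%N then eigen_functional l k else rational_functional l) W.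
  by apply: HF => // i; rewrite hom_density_clip.
have ratU : weakly_zero (rational_defect l (clip U)).
  apply: C4_weakly_zero; first exact: global_kernel_rational_defect.
  by have := H 5%N isT; rewrite /= (rational_functional_W l0 l1).
have eigU : forall k, eigenvector l (clip U) k.
  apply: (all_eigenvectors l0 l1 nU ratU) => k k5.
  apply: (eigen_functional_eigenvector nU).
  by have := H k (ltnW k5); rewrite k5 eigen_functional_W.
pose q := pclamp (clip U).
have bq : bmeas q := bmeas_pclamp nU.
have q1 x : `|q x| <= 1 := pclamp_le1 (clip U) x.
have UV := kernel_identified l0 l1 nU ratU bq q1 (pclamp_weak l0 l1 nU eigU).
move=> G; rewrite -hom_density_clip !hom_density_edge_prod//.
set S := enum _.
have lS e : e \in S -> (e.1 < e.2)%N by rewrite mem_enum => /andP[].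
rewrite (cube_mean_edge_prod_weak nU (global_kernel_wfun l0 l1 bq q1) UV (enum_uniq _) lS).
rewrite (W_wfun l0 l1); apply: (cube_mean_wfun_transfer l0 l1) => //.
- exact: bmeas_cpi.
- exact: cpi_le1.
- exact: (moment_pclamp l0 l1 nU eigU).
Qed.

Lemma W_not_weakly_isomorphic l' : 0 < l' -> l' <= 1 / 128 -> l <> l' ->
  ~ weakly_isomorphic W (W_lambda l').
Proof.
move=> l0' l1' ll' WW; apply: ll'.
have [m [F HF]] := @graph_determined_second_functional R.
have := HF _ _ (global_kernel_W l0 l1) (global_kernel_W l0' l1') (fun i => WW (F i)).
rewrite !second_functional_W// => /(mulIf _) /eqP; rewrite invr_eq0 pnatr_eq0 => /(_ isT).
by rewrite eqrXn2// ?ltW// => /eqP.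
Qed.
End forcibility.

(** * Analyticity of cosine series *)

Section limits.
Context {R : realType}.

Lemma cvg_norm_le (u : nat -> R) (L z e : R) K : u @ \oo --> L ->
  (forall n, (K <= n)%N -> `|u n - z| <= e) -> `|L - z| <= e.
Proof.
move=> uL H.
have c : (fun n => `|u n - z|) @ \oo --> `|L - z|.
  by apply: cvg_norm; apply: cvgB => //; exact: cvg_cst.
rewrite -(cvg_lim (@Rhausdorff R) c); apply: limr_le; first by apply/cvg_ex; exists `|L - z|.
by exists K.
Qed.

Lemma cvg_sum_seq I (s : seq I) (u : I -> nat -> R) (L : I -> R) :
  (forall i, u i @ \oo --> L i) ->
  (fun n => \sum_(i <- s) u i n) @ \oo --> \sum_(i <- s) L i.
Proof.
move=> uL; elim: s => [|i s IH].
  by under eq_fun do rewrite big_nil; rewrite big_nil; exact: cvg_cst.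
by under eq_fun do rewrite big_cons; rewrite big_cons; exact: cvgD.
Qed.

Lemma series_tail (m : nat -> R) : (forall n, 0 <= m n) -> cvgn (series m) ->
  forall e, 0 < e -> exists K, forall n, (K <= n)%N -> series m n - series m K <= e.
Proof.
move=> m0 cm e e0; have /cvgrPdist_le/(_ _ e0)[K _ HK] := cm.
exists K => n Kn; have nd : nondecreasing_seq (series m).
  by apply/nondecreasing_seqP => k; rewrite /series /= big_nat_recr//= lerDl.
have := HK K (leqnn K); have := nondecreasing_cvgn_le nd cm n.
by rewrite ler_norml; lra.
Qed.

(** Tannery's theorem: dominated convergence for series. *)
Lemma tannery (f : nat -> nat -> R) (g m F : nat -> R) (G : R) :
  (forall N n, `|f N n| <= m n) -> cvgn (series m) ->
  (forall n, (fun N => f N n) @ \oo --> g n) ->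
  (forall N, series (f N) @ \oo --> F N) -> series g @ \oo --> G ->
  F @ \oo --> G.
Proof.
move=> fm cm fg fF gG.
have m0 n : 0 <= m n by apply: le_trans (fm 0%N n).
have gm n : `|g n| <= m n.
  rewrite -[g n]subr0; apply: (cvg_norm_le (K := 0%N) (fg n)) => N _.
  by rewrite subr0.
apply/cvgrPdist_le => e e0; have e4 : 0 < e / 4 by rewrite divr_gt0.
have [K HK] := series_tail m0 cm e4.
have tail (h : nat -> R) (H : R) : (forall n, `|h n| <= m n) -> series h @ \oo --> H ->
    `|H - series h K| <= e / 4.
  move=> hm hH; apply: (cvg_norm_le (K := K) hH) => n Kn.
  apply: le_trans (HK n Kn); rewrite !sub_series_geq//.
  by rewrite (le_trans (ler_norm_sum _ _ _))// ler_sum.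
have fin : (fun N => series (f N) K) @ \oo --> series g K by exact: cvg_sum_seq.
have /cvgrPdist_le/(_ _ e4)[N0 _ HN0] := fin.
exists N0 => // N /HN0 h1.
have h2 := tail _ _ gm gG; have h3 := tail _ _ (fm N) (fF N).
have -> : G - F N = (G - series g K) + (series g K - series (f N) K) - (F N - series (f N) K).
  by ring.
rewrite (le_trans (ler_normB _ _))//; have := ler_normD (G - series g K) (series g K - series (f N) K).
move: h1 h2 h3 => /=; lra.
Qed.
End limits.

Section taylor_cosine.
Context {R : realType}.
Implicit Types a b h k x y : R.

Definition taylor_sign (t : R) i : R :=
  cos t * ((~~ odd i)%:R * (-1) ^+ i./2) - sin t * ((odd i)%:R * (-1) ^+ i.-1./2).

Lemma taylor_sign_le1 t i : `|taylor_sign t i| <= 1.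
Proof.
have s1 n : `|(-1) ^+ n : R| = 1 by rewrite normrX normrN1 expr1n.
rewrite /taylor_sign; case: (odd i) => /=.
  by rewrite mul0r mulr0 sub0r normrN normrM mul1r s1 mulr1 ler_norml sin_geN1 sin_le1.
by rewrite mul0r mulr0 subr0 normrM mul1r s1 mulr1 ler_norml cos_geN1 cos_le1.
Qed.

(** Taylor coefficients of x |-> cos (m pi x) at a. *)
Definition taylor_cos m a i : R :=
  taylor_sign (m%:R * pi * a) i * (m%:R * pi) ^+ i / i`!%:R.

Lemma taylor_cos_cvg m a x :
  (fun N => \sum_(i < N) taylor_cos m a i * (x - a) ^+ i) @ \oo --> cos (m%:R * pi * x).
Proof.
pose s : R := m%:R * pi * (x - a).
have -> : m%:R * pi * x = m%:R * pi * a + s by rewrite /s; ring.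
rewrite cosD.
have cC : series (cos_coeff s) @ \oo --> cos s.
  by rewrite [X in _ --> X](_ : _ = limn (series (cos_coeff s)));
    [exact: is_cvg_series_cos_coeff|rewrite unlock].
have cS : series (sin_coeff s) @ \oo --> sin s.
  by rewrite [X in _ --> X](_ : _ = limn (series (sin_coeff s)));
    [exact: is_cvg_series_sin_coeff|rewrite unlock].
pose A : R := cos (m%:R * pi * a); pose B : R := sin (m%:R * pi * a).
have cAC : (fun N => A * series (cos_coeff s) N) @ \oo --> A * cos s.
  by apply: cvgM => //; exact: cvg_cst.
have cBS : (fun N => B * series (sin_coeff s) N) @ \oo --> B * sin s.
  by apply: cvgM => //; exact: cvg_cst.
apply: cvg_trans (cvgB cAC cBS); apply: near_eq_cvg; apply: nearW => N /=.
transitivity (A * series (cos_coeff s) N - B * series (sin_coeff s) N); first by [].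
rewrite /series /= !big_mkord !mulr_sumr -sumrB; apply: eq_bigr => i _.
by rewrite /taylor_cos /taylor_sign /cos_coeff /sin_coeff /= /A /B /s (exprMn _ (m%:R * pi) (x - a)) -?exprnP; ring.
Qed.

(** Chosen so that exp (pi taylor_radius) = 2. *)
Definition taylor_radius : R := ln 2 / pi.

Lemma taylor_radius_gt0 : 0 < taylor_radius.
Proof. by rewrite divr_gt0 ?pi_gt0// ln_gt0// ltr1n. Qed.

(** The series is dominated by that of exp (m pi taylor_radius) = 2^m. *)
Lemma taylor_cos_abs m a h N : `|h| <= taylor_radius ->
  \sum_(i < N) `|taylor_cos m a i| * `|h| ^+ i <= 2 ^+ m.
Proof.
move=> hr; have r0 := taylor_radius_gt0.
pose t : R := m%:R * ln 2.
have t0 : 0 <= t by rewrite mulr_ge0// ltW// ln_gt0// ltr1n.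
have -> : 2 ^+ m = expR t :> R by rewrite expRM_natl lnK// posrE.
have nd : nondecreasing_seq (series (exp_coeff t)).
  by apply/nondecreasing_seqP => k; rewrite /series /= big_nat_recr//= lerDl exp_coeff_ge0.
have e1 : series (exp_coeff t) N <= expR t.
  by rewrite [expR t](_ : _ = limn (series (exp_coeff t)));
    [exact: (nondecreasing_cvgn_le nd (is_cvg_series_exp_coeff t))|by []].
apply: le_trans e1; rewrite /series /= big_mkord; apply: ler_sum => i _.
have p0 : 0 < pi :> R := pi_gt0 R.
have mp0 : 0 <= m%:R * pi :> R by rewrite mulr_ge0// ltW.
have -> : t = m%:R * pi * taylor_radius by rewrite /t /taylor_radius -mulrA (mulrC pi) divfK// gt_eqF.
rewrite /exp_coeff /= exprMn /taylor_cos !normrM normfV normr_nat normrX (ger0_norm mp0).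
have -> : `|taylor_sign (m%:R * pi * a) i| * (m%:R * pi) ^+ i / i`!%:R * `|h| ^+ i =
    (m%:R * pi) ^+ i / i`!%:R * (`|taylor_sign (m%:R * pi * a) i| * `|h| ^+ i) by ring.
rewrite [leRHS]mulrAC; apply: ler_wpM2l; first by rewrite divr_ge0// exprn_ge0.
rewrite -[leRHS]mul1r; apply: ler_pM; rewrite ?exprn_ge0//; first exact: taylor_sign_le1.
by apply: lerXn2r => //; rewrite nnegrE ltW.
Qed.

(** A series of products of cosines with coefficients decaying faster than the
    frequencies grow is analytic: expand every cosine at the given point and
    exchange the summations, which taylor_cos_abs makes absolutely convergent. *)
Lemma real_analytic_cos_series (w : nat -> R) (al be : nat -> nat) (g : R * R -> R) :
  cvgn (series (fun n => `|w n| * 2 ^+ al n * 2 ^+ be n)) ->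
  (forall x y, series (fun n => w n * cos ((al n)%:R * pi * x) * cos ((be n)%:R * pi * y))
     @ \oo --> g (x, y)) ->
  forall p, real_analytic_at g p.
Proof.
move=> cm wg [a b]; pose mj n : R := `|w n| * 2 ^+ al n * 2 ^+ be n.
have r0 := taylor_radius_gt0; pose r := taylor_radius.
pose A n i := taylor_cos (al n) a i; pose B n i := taylor_cos (be n) b i.
have one m c i : `|taylor_cos m c i| * r ^+ i <= 2 ^+ m.
  have rr : `|r| <= taylor_radius by rewrite gtr0_norm.
  apply: le_trans (taylor_cos_abs m c i.+1 rr); rewrite big_ord_recr /= (gtr0_norm r0) lerDr.
  by apply: sumr_ge0 => k _; rewrite mulr_ge0// exprn_ge0// ltW.
pose t i j n := w n * A n i * B n j.
have ct i j : cvgn (series (t i j)).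
  apply: normed_cvg; pose d := (r ^+ i * r ^+ j)^-1.
  have d0 : 0 <= d by rewrite invr_ge0 mulr_ge0// exprn_ge0// ltW.
  apply: (@series_le_cvg _ _ (fun n => d * mj n)) => [n|n|n|].
  - exact: normr_ge0.
  - by rewrite mulr_ge0// !mulr_ge0// exprn_ge0.
  - have key : `|t i j n| * (r ^+ i * r ^+ j) <= mj n.
      rewrite /t 2!normrM /mj.
      have -> : `|w n| * `|A n i| * `|B n j| * (r ^+ i * r ^+ j) =
         `|w n| * (`|A n i| * r ^+ i) * (`|B n j| * r ^+ j) by ring.
      by do 2! (apply: ler_pM; rewrite ?mulr_ge0 ?exprn_ge0 ?(ltW r0)//; try exact: one).
    have rr : 0 < r ^+ i * r ^+ j by rewrite mulr_gt0// exprn_gt0.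
    by rewrite /= mulrC ler_pdivlMr.
  - exact: is_cvg_seriesZ.
pose c i j := limn (series (t i j)).
have tc i j : series (t i j) @ \oo --> c i j by exact: ct.
exists c, r; split=> // x y /= xr yr.
pose h := x - a; pose k := y - b.
have hr : `|h| <= taylor_radius by exact: ltW.
have kr : `|k| <= taylor_radius by exact: ltW.
have mnd : nondecreasing_seq (series mj).
  by apply/nondecreasing_seqP => n; rewrite /series /= big_nat_recr//= lerDl !mulr_ge0// exprn_ge0.
have mlim n : series mj n <= limn (series mj) by exact: nondecreasing_cvgn_le.
have fac w0 N (f1 f2 : nat -> R) : \sum_(i < N) \sum_(j < N) w0 * f1 i * f2 j =
    w0 * (\sum_(i < N) f1 i) * (\sum_(j < N) f2 j).
  rewrite [w0 * _]mulr_sumr mulr_suml; apply: eq_bigr => i _; rewrite mulr_sumr.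
  by apply: eq_bigr.
split.
  apply: nondecreasing_is_cvgn.
    apply/nondecreasing_seqP => N; rewrite big_ord_recr /= -[leLHS]addr0.
    apply: lerD; last by apply: sumr_ge0.
    by apply: ler_sum => i _; rewrite big_ord_recr /= lerDl.
  exists (limn (series mj)) => _ [N _ <-].
  have cc : (fun K => \sum_(i < N) \sum_(j < N) `|series (t i j) K * h ^+ i * k ^+ j|) @ \oo -->
      \sum_(i < N) \sum_(j < N) `|c i j * h ^+ i * k ^+ j|.
    apply: cvg_sum_seq => i; apply: cvg_sum_seq => j; apply: cvg_norm.
    by apply: cvgM; [apply: cvgM => //; exact: cvg_cst|exact: cvg_cst].
  rewrite -(cvg_lim (@Rhausdorff R) cc); apply: limr_le; first by apply/cvg_ex; eexists; exact: cc.
  apply: nearW => K; apply: le_trans (mlim K).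
  apply: (@le_trans _ _ (\sum_(i < N) \sum_(j < N) \sum_(0 <= n < K)
      `|w n| * (`|A n i| * `|h| ^+ i) * (`|B n j| * `|k| ^+ j))).
    apply: ler_sum => i _; apply: ler_sum => j _.
    rewrite /series /= mulr_suml mulr_suml (le_trans (ler_norm_sum _ _ _))//.
    apply: ler_sum => n _; rewrite /t 4!normrM 2!normrX.
    by rewrite le_eqVlt; apply/orP; left; apply/eqP; ring.
  under eq_bigr => i _ do rewrite exchange_big /=.
  rewrite exchange_big /= /series /=; apply: ler_sum => n _.
  rewrite (fac _ _ (fun i => `|A n i| * `|h| ^+ i) (fun j => `|B n j| * `|k| ^+ j)) /mj.
  have pos (f : nat -> R) z : 0 <= \sum_(i < N) `|f i| * `|z : R| ^+ i.
    by apply: sumr_ge0 => i _; rewrite mulr_ge0// exprn_ge0.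
  apply: ler_pM; rewrite ?mulr_ge0 ?pos//; last exact: taylor_cos_abs.
  by apply: ler_pM; rewrite ?pos//; exact: taylor_cos_abs.
(* Partial sums of the expansion at p are series over n of products of partial
   Taylor sums, dominated by mj. *)
pose PA N n := \sum_(i < N) A n i * h ^+ i.
pose PB N n := \sum_(j < N) B n j * k ^+ j.
apply: (@tannery _ (fun N n => w n * PA N n * PB N n)
  (fun n => w n * cos ((al n)%:R * pi * x) * cos ((be n)%:R * pi * y)) mj).
- have bnd m z u N : `|z : R| <= taylor_radius ->
      `|\sum_(i < N) taylor_cos m u i * z ^+ i| <= 2 ^+ m.
    move=> zr; apply: le_trans (taylor_cos_abs m u N zr).
    rewrite (le_trans (ler_norm_sum _ _ _))// ler_sum// => i _.
    by rewrite normrM normrX.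
  move=> N n; rewrite 2!normrM /mj; apply: ler_pM; rewrite ?mulr_ge0//; last exact: bnd.
  by apply: ler_pM => //; exact: bnd.
- exact: cm.
- move=> n; apply: cvgM; last exact: taylor_cos_cvg.
  by apply: cvgM; [exact: cvg_cst|exact: taylor_cos_cvg].
- move=> N.
  have cc : (fun K => \sum_(i < N) \sum_(j < N) series (t i j) K * h ^+ i * k ^+ j) @ \oo -->
      \sum_(i < N) \sum_(j < N) c i j * h ^+ i * k ^+ j.
    apply: cvg_sum_seq => i; apply: cvg_sum_seq => j.
    by apply: cvgM; [apply: cvgM => //; exact: cvg_cst|exact: cvg_cst].
  apply: cvg_trans cc; apply: near_eq_cvg; apply: nearW => K; apply/esym.
  transitivity (\sum_(i < N) \sum_(j < N) \sum_(0 <= n < K)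
      w n * (A n i * h ^+ i) * (B n j * k ^+ j)); last first.
    apply: eq_bigr => i _; apply: eq_bigr => j _.
    rewrite /series /= mulr_suml mulr_suml; apply: eq_bigr => n _; rewrite /t; ring.
  under eq_bigr => i _ do rewrite exchange_big /=.
  rewrite exchange_big /= /series /=; apply: eq_bigr => n _.
  by rewrite (fac _ _ (fun i => A n i * h ^+ i) (fun j => B n j * k ^+ j)).
- exact: wg.
Qed.
End taylor_cosine.

(** * Analyticity of W_lambda and the theorem *)

Section W_analytic.
Context {R : realType}.
Variable l : R.
Hypotheses (l0 : 0 < l) (l1 : l <= 1 / 128).

(* W_lambda as one series of products of cosines: the first three terms are its
   constant and linear part, and the n-th one is the product of the cosines of
   frequency n - 2 from n = 3 on. *)
Let w n : R := nth (l ^+ (n - 2)) [:: 2^-1; 8^-1; 8^-1; 16^-1] n.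
Let al n : nat := nth (n - 2)%N [:: 0; 1; 0]%N n.
Let be n : nat := nth (n - 2)%N [:: 0; 0; 1]%N n.

Let majorant n : `|w n| * 2 ^+ al n * 2 ^+ be n <= geometric 4 2^-1 n.
Proof.
have [L0 L1] := (l0, l1).
case: n => [|[|[|[|n]]]]; rewrite /w /al /be /=; try by rewrite ger0_norm; lra.
rewrite nth_nil !subSS subn0 (ger0_norm (exprn_ge0 _ (ltW l0))) -mulrA -expr2 -exprM mulnC exprM.
rewrite -exprMn; apply: (@le_trans _ _ (2^-1 ^+ n.+2)).
  by apply: lerXn2r; rewrite ?nnegrE; lra.
by rewrite -[n.+4]addn2 [leRHS]mulrC exprD -mulrA; lra.
Qed.

Lemma W_real_analytic : real_analytic_kernel (W_lambda l).
Proof.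
exists [set: R * R], (fun p => W_lambda l p.1 p.2); split => //; first exact: openT.
move=> p _; apply: (@real_analytic_cos_series R w al be).
  apply: (@series_le_cvg _ _ (geometric 4 2^-1)) => [n|n||].
  - by rewrite !mulr_ge0// exprn_ge0.
  - by rewrite mulr_ge0// exprn_ge0.
  - exact: majorant.
  - by apply: is_cvg_geometric_series; rewrite ger0_norm; lra.
move=> x y; rewrite /= W_lambdaE//.
set u := cos (pi * x); set v := cos (pi * y).
have [u1 v1] : `|u| <= 1 /\ `|v| <= 1 by rewrite !cpi_le1.
rewrite -(cvg_shiftn 4).
have c1 : (fun n => ppart l (n + 2) u v) @ \oo --> poisson l u v.
  by have := ppart_cvg l0 l1 u1 v1; rewrite -(cvg_shiftn 2).
have c2 : (fun n => 2^-1 + (u + v) / 8 + u * v / 16 + (ppart l (n + 2) u v - 1 - l * u * v))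
    @ \oo --> wfun l u v.
  apply: cvgD; first exact: cvg_cst.
  by apply: cvgB; [apply: cvgB => //; exact: cvg_cst|exact: cvg_cst].
apply: cvg_trans c2; apply: near_eq_cvg; apply: nearW => n; apply/esym => /=.
elim: n => [|n IH].
  rewrite /series /= !big_nat_recr//= big_nil /ppart !big_ord_recr big_ord0 /=.
  by rewrite /w /al /be /pterm /= !mul0r cos0 !mul1r -/u -/v; ring.
rewrite addSn seriesSr IH.
rewrite addSn /ppart big_ord_recr /= -/(ppart l (n + 2) u v).
by rewrite /w /al /be /pterm !cheb_cos addn4 addn2 /= !nth_nil !subSS subn0 !mulrA; ring.
Qed.
End W_analytic.

Theorem theorem1p1 (R : realType) :
  (forall l : R, 0 < l -> l <= 1 / 128 ->
    [/\ is_kernel (W_lambda l), ~ ae_constant (W_lambda l),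
        real_analytic_kernel (W_lambda l) & finitely_forcible (W_lambda l)]) /\
  (forall l l' : R, 0 < l -> l <= 1 / 128 -> 0 < l' -> l' <= 1 / 128 ->
    l <> l' -> ~ weakly_isomorphic (W_lambda l) (W_lambda l')).
Proof.
split=> [l l0 l1|l l' l0 l1 l0' l1' ll']; last exact: W_not_weakly_isomorphic.
split; [exact: is_kernel_W|exact: W_not_ae_constant|exact: W_real_analytic|].
exact: W_finitely_forcible.
Qed.
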